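(* Let $k$ be a Hausdorff topological field of characteristic zero and let $G$ be a topological group. Then the natural morphism $$G\widehat{\otimes}k\longrightarrow \varprojlim_n\,(G/\overline{\Gamma^nG})\widehat{\otimes}k$$ is an isomorphism of pro-unipotent groups over $k$.
   Context: $\Gamma^1G=G$, $\Gamma^nG=(G,\Gamma^{n-1}G)$ is the lower central series and $\overline{\Gamma^nG}$ is the closure of $\Gamma^nG$ in $G$. A topological field is a field with a topology for which addition, multiplication, additive inversion and multiplicative inversion are continuous. An affine algebraic group over $k$ is unipotent if it has a closed embedding into the group of upper-unitriangular $m\times m$ matrices for some $m$; an affine group scheme over $k$ is pro-unipotent if all its finite-dimensional quotient group schemes are unipotent (equivalently it is an inverse limit of unipotent groups). For $U$ unipotent, $U(k)$ has the topology transported from $\mathrm{Lie}(U)\cong k^r$ (product topology) along the bijection $\exp:\mathrm{Lie}(U)\to U(k)$; for $U=\varprojlim_iU_i$ pro-unipotent, $U(k)=\varprojlim_iU_i(k)$ has the inverse limit topology. For a topological group $G$, the continuous Mal'cev $k$-completion $G\widehat{\otimes}k$ is the pro-unipotent group over $k$ representing the functor $U\mapsto\mathrm{Hom}_{\mathrm{cont}}(G,U(k))$ (continuous homomorphisms) on pro-unipotent groups over $k$; it always exists and is functorial in $G$. The natural morphism is induced by the quotient maps $G\to G/\overline{\Gamma^nG}$. *)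

(* Defs.v *)
From HB Require Import structures.
From mathcomp Require Import all_boot ssralg poly matrix.
From mathcomp Require Import all_classical topology tvs.

Set Implicit Arguments.
Unset Strict Implicit.
Unset Printing Implicit Defensive.

Import GRing.Theory.
Local Open Scope classical_set_scope.
Local Open Scope quotient_scope.
Local Open Scope ring_scope.

HB.mixin Record isTopologicalField K & Topological K & GRing.Field K := {
  mulf_continuous : continuous (fun x : K * K => x.1 * x.2);
  invf_continuous : {within [set x : K | x != 0], continuous (@GRing.inv K)}
}.

#[short(type="topologicalFieldType")]
HB.structure Definition TopologicalField :=
  {K of TopologicalZmodule K & GRing.Field K & isTopologicalField K}.

HB.mixin Record isTopologicalGroup G & Topological G & Group G := {
  mulg_continuous : continuous (fun x : G * G => (x.1 * x.2)%g);
  invg_continuous : continuous (fun x : G => (x^-1)%g)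
}.

#[short(type="topologicalGroupType")]
HB.structure Definition TopologicalGroup :=
  {G of Topological G & Group G & isTopologicalGroup G}.

Section Subgroups.
Local Open Scope group_scope.

Definition is_subgroup (G : groupType) (H : set G) : Prop :=
  [/\ H 1, forall x y, H x -> H y -> H (x * y) & forall x, H x -> H x^-1].

(* [lcs G n] is $\Gamma^{n+1} G$. *)
Fixpoint lcs (G : groupType) (n : nat) : set G :=
  if n is m.+1 then
    smallest (@is_subgroup G) [set z | exists x y : G, lcs m y /\ z = [~ x, y]]
  else setT.

Arguments lcs : clear implicits.

Record normalSubgroup (G : groupType) := NormalSubgroup {
  normal_set :> set G;
  normal_subgroup : is_subgroup normal_set;
  normal_conj : forall x y, normal_set x -> normal_set (x ^ y)
}.

Lemma smallest_subgroup (G : groupType) (S : set G) :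
  is_subgroup (smallest (@is_subgroup G) S).
Proof.
split=> [H [[]] //|x y xS yS H HS|x xS H HS].
  by have [[_ M _] _] := HS; apply: M; [exact: xS|exact: yS].
by have [[_ _ V] _] := HS; apply: V; exact: xS.
Qed.

Lemma lcs_subgroup (G : groupType) n : is_subgroup (lcs G n).
Proof. by case: n => [|n]; [split|exact: smallest_subgroup]. Qed.

Lemma lcs_conj (G : groupType) n (x y : G) : lcs G n x -> lcs G n (x ^ y).
Proof.
elim: n x y => [//|n IHn] x y xn H HS.
apply: (xn [set x | H (x ^ y)]); split; first split.
- by rewrite /= conj1g; case: HS.1.
- by move=> a b /= Ha Hb; rewrite conjMg; have [_ M _] := HS.1; exact: M.
- by move=> a /= Ha; rewrite conjVg; have [_ _ V] := HS.1; exact: V.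
move=> _ [a [b [bn ->]]] /=; apply: HS.2.
by exists (a ^ y), (b ^ y); split; [exact: IHn|rewrite conjRg].
Qed.

Lemma lcsS (G : groupType) n : lcs G n.+1 `<=` lcs G n.
Proof.
move=> x; apply; split; first exact: lcs_subgroup.
move=> _ [a [b [bn ->]]]; rewrite commgEr.
have [_ M V] := lcs_subgroup G n.
by apply: M => //; apply: lcs_conj; exact: V.
Qed.

Section Quotient.
Variables (G : topologicalGroupType) (N : normalSubgroup G).

Definition coset_rel : rel G := fun x y => `[< normal_set N (x^-1 * y) >].

Lemma coset_refl : reflexive coset_rel.
Proof. by move=> x; apply/asboolP; rewrite mulVg; case: (normal_subgroup N). Qed.

Lemma coset_sym : symmetric coset_rel.
Proof.
have [_ _ V] := normal_subgroup N.
by move=> x y; apply/asboolP/asboolP => /V; rewrite invgM invgK.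
Qed.

Lemma coset_trans : transitive coset_rel.
Proof.
have [_ M _] := normal_subgroup N.
move=> y x z /asboolP xy /asboolP yz; apply/asboolP.
by have := M _ _ xy yz; rewrite -mulgA mulVKg.
Qed.

Canonical coset_equiv := EquivRel coset_rel coset_refl coset_sym coset_trans.

Definition topQuotient := quotient_topology {eq_quot coset_equiv}.

HB.instance Definition _ := Topological.on topQuotient.
HB.instance Definition _ := Quotient.on topQuotient.

Definition coset_map (x : G) : topQuotient := \pi_topQuotient x.

Lemma coset_mapP x y : coset_map x = coset_map y <-> normal_set N (x^-1 * y).
Proof. by split=> [/eqquotP/asboolP|?]; last apply/eqquotP/asboolP. Qed.

Lemma coset_reprK u : coset_map (repr u) = u.
Proof. exact: reprK. Qed.

Definition coset_mul (u v : topQuotient) : topQuotient :=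
  coset_map (repr u * repr v).
Definition coset_inv (u : topQuotient) : topQuotient := coset_map (repr u)^-1.

Lemma coset_mulE x y : coset_mul (coset_map x) (coset_map y) = coset_map (x * y).
Proof.
have [_ M _] := normal_subgroup N.
apply/coset_mapP; set a := repr _; set b := repr _.
have Na : normal_set N (a^-1 * x) by apply/coset_mapP; rewrite coset_reprK.
have Nb : normal_set N (b^-1 * y) by apply/coset_mapP; rewrite coset_reprK.
have -> : (a * b)^-1 * (x * y) = (a^-1 * x) ^ b * (b^-1 * y).
  by rewrite conjgE invgM !mulgA mulgK.
by apply: M => //; exact: normal_conj.
Qed.

Lemma coset_invE x : coset_inv (coset_map x) = coset_map x^-1.
Proof.
have [_ _ V] := normal_subgroup N.
apply/coset_mapP; set a := repr _; rewrite invgK.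
have /V : normal_set N (a^-1 * x) by apply/coset_mapP; rewrite coset_reprK.
rewrite invgM invgK => /(@normal_conj _ N _ a^-1).
by rewrite conjgE invgK -mulgA mulgV mulg1.
Qed.

Lemma coset_ind (P : topQuotient -> Prop) : (forall x, P (coset_map x)) -> forall u, P u.
Proof. by move=> Pm u; rewrite -(coset_reprK u). Qed.

Lemma coset_mulA : associative coset_mul.
Proof.
move=> u v w; elim/coset_ind: u => x; elim/coset_ind: v => y.
by elim/coset_ind: w => z; rewrite !coset_mulE mulgA.
Qed.

Lemma coset_mul1 : left_id (coset_map 1) coset_mul.
Proof. by elim/coset_ind => x; rewrite coset_mulE mul1g. Qed.

Lemma coset_1mul : right_id (coset_map 1) coset_mul.
Proof. by elim/coset_ind => x; rewrite coset_mulE mulg1. Qed.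

Lemma coset_mulV : left_inverse (coset_map 1) coset_inv coset_mul.
Proof. by elim/coset_ind => x; rewrite coset_invE coset_mulE mulVg. Qed.

Lemma coset_Vmul : right_inverse (coset_map 1) coset_inv coset_mul.
Proof. by elim/coset_ind => x; rewrite coset_invE coset_mulE mulgV. Qed.

HB.instance Definition _ := isGroup.Build topQuotient
  coset_mulA coset_mul1 coset_1mul coset_mulV coset_Vmul.

Lemma coset_mapM x y : coset_map (x * y) = coset_map x * coset_map y.
Proof. by rewrite -coset_mulE. Qed.

Lemma coset_map_continuous : continuous coset_map.
Proof. exact: pi_continuous. Qed.

Lemma mulgl_continuous (a : G) : continuous (fun x : G => a * x).
Proof.
move=> x; apply: (@continuous_comp _ _ _ (fun x => (a, x)) (fun z : G * G => z.1 * z.2)).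
  by apply: cvg_pair => /=; [exact: cvg_cst|exact: cvg_id].
exact: mulg_continuous.
Qed.

Lemma mulgr_continuous (a : G) : continuous (fun x : G => x * a).
Proof.
move=> x; apply: (@continuous_comp _ _ _ (fun x => (x, a)) (fun z : G * G => z.1 * z.2)).
  by apply: cvg_pair => /=; [exact: cvg_id|exact: cvg_cst].
exact: mulg_continuous.
Qed.

Lemma coset_map_open (A : set G) : open A -> open (coset_map @` A).
Proof.
move=> oA; change (open (coset_map @^-1` (coset_map @` A))).
have -> : coset_map @^-1` (coset_map @` A) =
    \bigcup_(n in normal_set N) ((fun x => x * n) @^-1` A).
  apply/seteqP; split=> x /=.
    by move=> [a Aa /esym/coset_mapP Nxa]; exists (x^-1 * a) => //=; rewrite mulgA mulgV mul1g.
  move=> [n Nn /= Axn]; exists (x * n) => //; apply/esym/coset_mapP.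
  by rewrite mulgA mulVg mul1g.
apply: bigcup_open => n _; apply: open_comp => // x _; exact: mulgr_continuous.
Qed.

Lemma coset_map_nbhs (x : G) (A : set G) : nbhs x A -> nbhs (coset_map x) (coset_map @` A).
Proof.
rewrite nbhsE => -[B [oB Bx] BA].
apply: (@filterS _ _ _ (coset_map @` B)); first exact: image_subset.
by apply: open_nbhs_nbhs; split; [exact: coset_map_open|exists x].
Qed.

Lemma topQuotient_mul_continuous :
  continuous (fun u : topQuotient * topQuotient => u.1 * u.2).
Proof.
move=> [u v]; elim/coset_ind: u => x; elim/coset_ind: v => y /= A /=.
rewrite -coset_mapM => /coset_map_continuous /= Axy.
have [[B C] /= [Bx Cy] BC] := @mulg_continuous G (x, y) _ Axy.
exists (coset_map @` B, coset_map @` C); first by split; exact: coset_map_nbhs.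
move=> [_ _] /= [[b Bb <-] [c Cc <-]]; rewrite -coset_mapM.
exact: (BC (b, c)).
Qed.

Lemma topQuotient_inv_continuous : continuous (fun u : topQuotient => u^-1).
Proof.
elim/coset_ind => x A; rewrite [X in nbhs X](coset_invE x).
move=> /coset_map_continuous Ax.
have /coset_map_nbhs := @invg_continuous G x _ Ax.
by apply: filterS => _ [y /= Ay <-]; rewrite -coset_invE in Ay.
Qed.

HB.instance Definition _ := isTopologicalGroup.Build topQuotient
  topQuotient_mul_continuous topQuotient_inv_continuous.

End Quotient.

Lemma closure_morph (G : topologicalGroupType) (A : set G) (f : G -> G) :
  continuous f -> (forall x, A x -> A (f x)) ->
  forall x, closure A x -> closure A (f x).
Proof.
move=> cf Af x clx B /cf Bfx.
by have [y [/Af Ay By]] := clx _ Bfx; exists (f y).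
Qed.

Lemma closure_subgroup (G : topologicalGroupType) (A : set G) :
  is_subgroup A -> is_subgroup (closure A).
Proof.
move=> [A1 AM AV]; split.
- exact: subset_closure.
- move=> x y clx cly B /(@mulg_continuous G (x, y)) [[C D] /= [Cx Dy] CD].
  have [a [Aa Ca]] := clx _ Cx; have [b [Ab Db]] := cly _ Dy.
  by exists (a * b); split; [exact: AM|exact: (CD (a, b))].
- by apply: closure_morph AV; exact: invg_continuous.
Qed.

Lemma closure_conj (G : topologicalGroupType) (A : set G) :
  (forall x y, A x -> A (x ^ y)) ->
  forall x y, closure A x -> closure A (x ^ y).
Proof.
move=> AJ x y; apply: (@closure_morph _ _ (fun x => x ^ y)) => [{}x|z]; last exact: AJ.
apply: (@continuous_comp _ _ _ (fun z => z * y) (fun z => y^-1 * z)).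
  exact: mulgr_continuous.
exact: mulgl_continuous.
Qed.

Definition closed_lcs (G : topologicalGroupType) (n : nat) : normalSubgroup G :=
  NormalSubgroup (closure_subgroup (lcs_subgroup G n))
                 (closure_conj (@lcs_conj G n)).

Definition lcsQuotient (G : topologicalGroupType) (n : nat) :
  topologicalGroupType := topQuotient (closed_lcs G n).

Definition lcs_coset (G : topologicalGroupType) (n : nat) :
  G -> lcsQuotient G n := coset_map (closed_lcs G n).

Definition lcs_proj (G : topologicalGroupType) (n : nat) :
  lcsQuotient G n.+1 -> lcsQuotient G n := fun u => lcs_coset n (repr u).

Lemma lcs_projE (G : topologicalGroupType) n (x : G) :
  lcs_proj (lcs_coset n.+1 x) = lcs_coset n x.
Proof.
apply/coset_mapP; set a := repr _.
have : normal_set (closed_lcs G n.+1) (a^-1 * x) by apply/coset_mapP; rewrite coset_reprK.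
by apply: closure_subset; exact: lcsS.
Qed.

Definition cont_hom (G H : topologicalGroupType) (f : G -> H) : Prop :=
  continuous f /\ {morph f : x y / x * y}.

Lemma lcs_coset_hom (G : topologicalGroupType) n : cont_hom (@lcs_coset G n).
Proof. by split; [exact: coset_map_continuous|exact: coset_mapM]. Qed.

Lemma lcs_proj_hom (G : topologicalGroupType) n : cont_hom (@lcs_proj G n).
Proof.
split; first apply/quotient_continuous.
  rewrite [X in continuous X](_ : _ = @lcs_coset G n).
    exact: coset_map_continuous.
  by apply/funext => x; exact: lcs_projE.
elim/coset_ind => x; elim/coset_ind => y.
by rewrite -coset_mapM !lcs_projE; exact: coset_mapM.
Qed.

End Subgroups.

Section GroupSchemes.
Variable k : fieldType.
Implicit Types A R S : comAlgType k.

Lemma lrmorphism_ext A R (x y : {lrmorphism A -> R}) : x =1 y -> x = y.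
Proof.
case: x y => [x [[a] [b] [c]]] [y [[a'] [b'] [c']]] /= /funext exy.
rewrite /= in exy; subst y.
by congr (GRing.LRMorphism.Pack (GRing.LRMorphism.Class _ _ _));
  apply: congr1; exact: Prop_irrelevance.
Qed.

Definition lrcomp A R S (g : {lrmorphism R -> S}) (f : {lrmorphism A -> R}) :
  {lrmorphism A -> S} := g \o f.

(* An affine group scheme over [k], as a representable group-valued functor:   *)
(* [coord] is the coordinate ring and the [R]-points are the [k]-algebra maps  *)
(* from [coord] to [R], with a group law natural in [R].  A [comAlgType] is    *)
(* non-zero; nothing is lost, as every scheme has a single point over the zero *)
(* ring.                                                                       *)
Record affGroup := AffGroup {
  coord : comAlgType k;
  pmul : forall R,
    {lrmorphism coord -> R} -> {lrmorphism coord -> R} -> {lrmorphism coord -> R};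
  pone : forall R, {lrmorphism coord -> R};
  pinv : forall R, {lrmorphism coord -> R} -> {lrmorphism coord -> R};
  pmulA : forall R, associative (@pmul R);
  pmul1 : forall R, left_id (@pone R) (@pmul R);
  p1mul : forall R, right_id (@pone R) (@pmul R);
  pmulV : forall R, left_inverse (@pone R) (@pinv R) (@pmul R);
  pVmul : forall R, right_inverse (@pone R) (@pinv R) (@pmul R);
  pmul_nat : forall R S (h : {lrmorphism R -> S}) (x y : {lrmorphism coord -> R}),
    lrcomp h (pmul x y) = pmul (lrcomp h x) (lrcomp h y)
}.

Definition points (U : affGroup) (R : comAlgType k) : Type :=
  {lrmorphism coord U -> R}.

HB.instance Definition _ U R := gen_eqMixin (points U R).
HB.instance Definition _ U R := gen_choiceMixin (points U R).
HB.instance Definition _ U R := isGroup.Build (points U R)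
  (@pmulA U R) (@pmul1 U R) (@p1mul U R) (@pmulV U R) (@pVmul U R).

Definition points_map (U : affGroup) R S (h : {lrmorphism R -> S})
  (x : points U R) : points U S := lrcomp h x.

Record affHom (U V : affGroup) := AffHom {
  comorph : {lrmorphism coord V -> coord U};
  comorphM : forall R,
    {morph (fun x : points U R => lrcomp x comorph : points V R) : x y / (x * y)%g}
}.

Definition hom_points (U V : affGroup) (f : affHom U V) R (x : points U R) :
  points V R := lrcomp x (comorph f).

Lemma affHom_ext (U V : affGroup) (f g : affHom U V) :
  comorph f = comorph g -> f = g.
Proof.
case: f g => [f fM] [g gM] /= E; subst g.
by congr AffHom; exact: Prop_irrelevance.
Qed.

Definition affHom_id (U : affGroup) : affHom U U.
Proof.
exists (idfun : {lrmorphism coord U -> coord U}) => R x y.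
have E (z : points U R) : (lrcomp z idfun : points U R) = z.
  exact: lrmorphism_ext.
by rewrite !E.
Defined.

Definition affHom_comp (U V W : affGroup) (g : affHom V W) (f : affHom U V) :
  affHom U W.
Proof.
exists (lrcomp (comorph f) (comorph g)) => R x y.
have E (z : points U R) : (lrcomp z (lrcomp (comorph f) (comorph g)) : points W R)
    = hom_points g (hom_points f z) by exact: lrmorphism_ext.
by rewrite !E [hom_points f _]comorphM [hom_points g _]comorphM.
Defined.

Definition affHom_iso (U V : affGroup) (f : affHom U V) : Prop :=
  exists g : affHom V U,
    affHom_comp g f = affHom_id U /\ affHom_comp f g = affHom_id V.

(* For affine group schemes over a field, a homomorphism is a quotient map     *)
(* (faithfully flat) iff its comorphism is injective.                          *)
Definition quotient_hom (U V : affGroup) (f : affHom U V) : Prop :=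
  injective (comorph f).

Definition is_subalgebra A (B : set A) : Prop :=
  [/\ forall c : k, B c%:A, forall a b, B a -> B b -> B (a + b)
    & forall a b, B a -> B b -> B (a * b)].

Definition generates A (S : set A) : Prop := smallest (@is_subalgebra A) S = setT.

Definition algebraic (U : affGroup) : Prop :=
  exists s : seq (coord U), generates [set` s].

Definition unitriangular (R : comNzRingType) m (M : 'M[R]_m) : Prop :=
  forall i j : 'I_m, (j <= i)%N -> M i j = (i == j)%:R.

(* A closed embedding of [U] into the group of unitriangular matrices: a       *)
(* natural homomorphism into unitriangular matrices whose comorphism is onto.  *)
(* The comorphism sends the coordinate functions to the entries of the image   *)
(* of the universal point [idfun], so being onto means that these generate the *)
(* coordinate ring.                                                            *)
Record unitri_embedding (U : affGroup) (m : nat)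
    (rho : forall R, points U R -> 'M[R]_m) : Prop := {
  rho_nat : forall R S (h : {lrmorphism R -> S}) (x : points U R),
    rho S (points_map h x) = map_mx h (rho R x);
  rho_unitri : forall R (x : points U R), unitriangular (rho R x);
  rhoM : forall R (x y : points U R), rho R (x * y)%g = rho R x *m rho R y;
  rho_closed : generates
    [set a | exists i j, a = rho (coord U) (idfun : {lrmorphism _ -> _}) i j]
}.

Definition unipotent (U : affGroup) : Prop :=
  exists (m : nat) (rho : forall R, points U R -> 'M[R]_m), unitri_embedding rho.

(* Finite-dimensional quotient group schemes are the quotients that are        *)
(* algebraic groups, i.e. of finite type over [k].                             *)
Definition pro_unipotent (U : affGroup) : Prop :=
  forall (V : affGroup) (q : affHom U V),
    quotient_hom q -> algebraic V -> unipotent V.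

Record prounipotentGroup := ProunipotentGroup {
  pro_group :> affGroup;
  pro_groupP : pro_unipotent pro_group
}.

Section PolyEval.
Variables (R : comAlgType k) (r : R).

Definition poly_eval (p : {poly k}) : R := horner_alg r p.

Lemma poly_eval_semilinear : semilinear poly_eval.
Proof.
split=> [c p|p q]; rewrite /poly_eval; last exact: rmorphD.
by rewrite -mul_polyC rmorphM /= horner_algC mulr_algl.
Qed.

Lemma poly_eval_monoid : monoid_morphism poly_eval.
Proof. by split=> [|p q]; rewrite /poly_eval ?rmorph1 ?rmorphM. Qed.

HB.instance Definition _ :=
  GRing.isSemilinear.Build k {poly k} R *:%R poly_eval poly_eval_semilinear.
HB.instance Definition _ :=
  GRing.isMonoidMorphism.Build {poly k} R poly_eval poly_eval_monoid.

Definition poly_point : {lrmorphism {poly k} -> R} := poly_eval.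

Lemma poly_pointX : poly_point 'X = r.
Proof. exact: horner_algX. Qed.

End PolyEval.

Lemma poly_pointE R (x y : {lrmorphism {poly k} -> R}) : x 'X = y 'X -> x = y.
Proof.
move=> xy; apply: lrmorphism_ext => p.
by rewrite poly_alg_initial [RHS]poly_alg_initial xy.
Qed.

(* The additive group: [coord] is [k[X]] and a point is determined by its      *)
(* value at ['X], on which the group law is addition.                          *)
Definition Ga : affGroup.
Proof.
apply: (@AffGroup {poly k} (fun R x y => poly_point (x 'X + y 'X))
  (fun R => poly_point 0) (fun R x => poly_point (- x 'X))) => R.
- by move=> x y z; apply: poly_pointE; rewrite !poly_pointX addrA.
- by move=> x; apply: poly_pointE; rewrite !poly_pointX add0r.
- by move=> x; apply: poly_pointE; rewrite !poly_pointX addr0.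
- by move=> x; apply: poly_pointE; rewrite !poly_pointX addNr.
- by move=> x; apply: poly_pointE; rewrite !poly_pointX subrr.
- move=> S h x y; apply: poly_pointE.
  by rewrite /lrcomp /= -!/(poly_point _) !poly_pointX rmorphD.
Defined.

(* The Lie algebra of [U]: point derivations of [coord U] at the identity. *)
Definition is_lie (U : affGroup) (X : coord U -> k^o) : Prop :=
  linear X /\
  forall a b, X (a * b) = (1%g : points U k^o) a * X b + X a * (1%g : points U k^o) b.

Definition lie_comb (U : affGroup) r (e : 'I_r -> coord U -> k^o) (x : 'rV[k]_r) :
  coord U -> k^o := fun a => \sum_i x ord0 i * e i a.

Definition lie_basis (U : affGroup) r (e : 'I_r -> coord U -> k^o) : Prop :=
  (forall i, is_lie (e i)) /\
  forall X, is_lie X -> exists! x : 'rV[k]_r, X = lie_comb e x.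

(* [g = exp X]: [g] is the value at 1 of the one-parameter subgroup            *)
(* [gamma : Ga -> U] with derivative [X] at 0.                                 *)
Definition is_exp (U : affGroup) (X : coord U -> k^o) (g : points U k^o) : Prop :=
  exists gamma : affHom Ga U,
    (forall a, X a = (comorph gamma a)`_1) /\
    g = hom_points gamma (poly_point (1 : k^o)).

Definition lie_exp (U : affGroup) (X : coord U -> k^o) : points U k^o :=
  xget 1%g (@is_exp U X).

End GroupSchemes.

Section Topology.
Variable k : topologicalFieldType.

(* For [U] unipotent: the topology on [U(k)] transported along the bijection   *)
(* [exp] from [Lie(U)], identified with [k^r] by a basis.                      *)
Definition exp_open (U : affGroup k) (W : set (points U k^o)) : Prop :=
  forall r (e : 'I_r -> coord U -> k^o), lie_basis e ->
    open [set x : 'rV[k]_r | W (lie_exp (lie_comb e x))].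

Definition kpoints (U : prounipotentGroup k) : Type := points U k^o.

HB.instance Definition _ U := Group.on (kpoints U).

(* The inverse limit topology for [U] the limit of its unipotent algebraic     *)
(* quotients [V], each [V(k)] having the topology above.                       *)
Definition kpoints_subbase (U : prounipotentGroup k) : set (set (kpoints U)) :=
  [set W | exists (V : affGroup k) (q : affHom U V) (W' : set (points V k^o)),
    [/\ quotient_hom q, algebraic V, exp_open W'
      & W = (@hom_points _ _ _ q k^o) @^-1` W']].

HB.instance Definition _ U :=
  isSubBaseTopological.Build (kpoints U) (@kpoints_subbase U) id.

Definition kpoints_map (U V : prounipotentGroup k) (f : affHom U V) :
  kpoints U -> kpoints V := @hom_points _ _ _ f k^o.

Definition cont_khom (G : topologicalGroupType) (U : prounipotentGroup k)
  (f : G -> kpoints U) : Prop := continuous f /\ {morph f : x y / (x * y)%g}.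

Record malcev (G : topologicalGroupType) := Malcev {
  malcev_group :> prounipotentGroup k;
  malcev_unit : G -> kpoints malcev_group;
  malcev_unitP : cont_khom malcev_unit;
  malcev_univ : forall (U : prounipotentGroup k) (f : G -> kpoints U),
    cont_khom f ->
    exists! phi : affHom malcev_group U, f = kpoints_map phi \o malcev_unit
}.

Lemma cont_khom_comp (G H : topologicalGroupType) (U : prounipotentGroup k)
  (f : G -> H) (g : H -> kpoints U) :
  cont_hom f -> cont_khom g -> cont_khom (g \o f).
Proof.
move=> [cf fM] [cg gM]; split=> [x|x y /=]; last by rewrite fM gM.
by apply: continuous_comp; [exact: cf|exact: cg].
Qed.

Definition malcev_lift (G : topologicalGroupType) (C : malcev G)
    (U : prounipotentGroup k) (f : G -> kpoints U) (fP : cont_khom f) :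
  affHom C U := projT1 (cid (malcev_univ C fP)).

Lemma malcev_liftE (G : topologicalGroupType) (C : malcev G)
    (U : prounipotentGroup k) (f : G -> kpoints U) (fP : cont_khom f) :
  kpoints_map (malcev_lift C fP) \o malcev_unit C = f.
Proof. by rewrite /malcev_lift; case: cid => phi [/= E _]. Qed.

Lemma malcev_lift_unique (G : topologicalGroupType) (C : malcev G)
    (U : prounipotentGroup k) (f : G -> kpoints U) (fP : cont_khom f)
    (phi : affHom C U) :
  kpoints_map phi \o malcev_unit C = f -> phi = malcev_lift C fP.
Proof. by rewrite /malcev_lift; case: cid => psi [/= _ U1] /esym/U1. Qed.

Definition malcev_map (G H : topologicalGroupType) (C : malcev G) (D : malcev H)
    (f : G -> H) (fP : cont_hom f) : affHom C D :=
  malcev_lift C (cont_khom_comp fP (malcev_unitP D)).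

Record tower_limit (M : nat -> prounipotentGroup k)
    (t : forall n, affHom (M n.+1) (M n)) := TowerLimit {
  limit_group :> prounipotentGroup k;
  limit_proj : forall n, affHom limit_group (M n);
  limit_compat : forall n, affHom_comp (t n) (limit_proj n.+1) = limit_proj n;
  limit_univ : forall (V : prounipotentGroup k) (c : forall n, affHom V (M n)),
    (forall n, affHom_comp (t n) (c n.+1) = c n) ->
    exists! p : affHom V limit_group, forall n, affHom_comp (limit_proj n) p = c n
}.

Definition limit_lift (M : nat -> prounipotentGroup k)
    (t : forall n, affHom (M n.+1) (M n)) (L : tower_limit t)
    (V : prounipotentGroup k) (c : forall n, affHom V (M n))
    (cP : forall n, affHom_comp (t n) (c n.+1) = c n) : affHom V L :=
  projT1 (cid (limit_univ L cP)).

Section Natural.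
Variables (G : topologicalGroupType) (C : malcev G).
Variable Cn : forall n, malcev (lcsQuotient G n).

Definition lcs_transition (n : nat) : affHom (Cn n.+1) (Cn n) :=
  malcev_map (Cn n.+1) (Cn n) (lcs_proj_hom G n).

Definition lcs_component (n : nat) : affHom C (Cn n) :=
  malcev_map C (Cn n) (lcs_coset_hom G n).

Lemma lcs_component_compat n :
  affHom_comp (lcs_transition n) (lcs_component n.+1) = lcs_component n.
Proof.
apply: malcev_lift_unique; apply/funext => x /=.
have E1 := congr1 (@^~ x) (malcev_liftE C
  (cont_khom_comp (lcs_coset_hom G n.+1) (malcev_unitP (Cn n.+1)))).
have E2 := congr1 (@^~ (lcs_coset n.+1 x)) (malcev_liftE (Cn n.+1)
  (cont_khom_comp (lcs_proj_hom G n) (malcev_unitP (Cn n)))).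
rewrite /= in E1 E2; rewrite lcs_projE in E2.
rewrite -[RHS]E2 -E1; exact: lrmorphism_ext.
Qed.

Definition natural_map (L : tower_limit lcs_transition) : affHom C L :=
  limit_lift L lcs_component_compat.

End Natural.
End Topology.

(* Main.v *)
From HB Require Import structures.
Require Import Defs.
From mathcomp Require Import all_boot finmap ssralg zmodp poly matrix.
From mathcomp Require Import all_classical topology tvs.
From mathcomp Require Import ring.

(** A continuous homomorphism from [G] to the [k]-points of an algebraic
unipotent group [U] kills some [closed_lcs G n]: it kills a term of the lower
central series because [U] is nilpotent, hence its closure because [1] is closed
in [U(k)].  For the latter one needs that the exponential exists on all of
[Lie(U)] and that [exp X = 1] forces [X = 0] (characteristic zero).

Every element of the coordinate ring [A] of the completion of [G] lies in a
finitely generated Hopf subalgebra, i.e. comes from an algebraic unipotent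
quotient, so by the above it comes from the coordinate ring [A_n] of the
completion of some [G / closed_lcs G n].  Conversely [A_n] embeds in [A]: the
image of the completion of [G] in that of the quotient receives a continuous
homomorphism from the quotient, so by the universal property its inclusion is
split.  Hence [A] is the increasing union of the [A_n]. *)

Set Implicit Arguments.
Unset Strict Implicit.
Unset Printing Implicit Defensive.

Import GRing.Theory.
Local Open Scope classical_set_scope.
Local Open Scope quotient_scope.
Local Open Scope ring_scope.

(* [classical.functions] also exports a [pinv]. *)
Local Notation pinv := Defs.pinv.

(** Groups are handled through coordinate rings: by Yoneda a natural group law on points is a
    comultiplication, and quotients of a group are Hopf subalgebras of its coordinate ring. For a
    subalgebra $B$ of $A$ to inherit the comultiplication, $B\otimes B\to A\otimes A$ must be
    injective; linear retractions, available over a field, give this.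

    The topology on $U(k)$ is generated by algebraic quotients, so continuity is immediate for
    quotient homomorphisms but not for closed embeddings. This is why the image is used: it is a
    quotient of the completion of $G$, so the map from $G$ to its points is continuous, while its
    embedding enters only through injectivity on points and uniqueness in the universal property.

    The chosen exponential has default value [1], so its values mean nothing until an exponential is
    shown to exist. It is built from the Taylor coefficients of an invariant derivation, which
    vanish in high degree by nilpotency.

    A union of coordinate rings is an inverse limit of groups: the completion of $G$ is itself a
    limit of the tower, which gives existence, and the isomorphism is uniqueness of limits. *)

Lemma linear_retract (k : fieldType) (V W : lmodType k) (j : {linear V -> W}) :
  injective j -> exists r : {linear W -> V}, cancel j r.
Proof.
move=> jinj.
(* Graphs of partial linear maps inverting [j]. The last clause is conditional because the empty
   chain has the empty union. *)
pose P (S : set (W * V)) := [/\ forall c x y, S x -> S y -> S (c *: x + y),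
  forall v, S (0, v) -> v = 0 & S !=set0 -> forall v, S (j v, v)].
have [F FP Ftot|A [[AD A0 AJ] Amax]] := @Zorn_bigcup _ P.
  split=> [c x y [S FS Sx] [S' FS' Sy]|v [S FS S0]|[x [S FS Sx]] v].
  - have [SS'|S'S] := Ftot _ _ FS FS'.
      by exists S' => //; have [D _ _] := FP _ FS'; apply: D => //; exact: SS'.
    by exists S => //; have [D _ _] := FP _ FS; apply: D => //; exact: S'S.
  - by have [_ + _] := FP _ FS; apply.
  - by exists S => //; have [_ _ J] := FP _ FS; apply: J; exists x.
have A_neq0 : A !=set0.
  have [A0'|//] := pselect (A = set0); last by move/eqP/set0P.
  exfalso; have /Amax : A `<` [set x | x.1 = j x.2].
    by rewrite A0' properEneq; split=> //; apply/eqP => /esym/(congr1 (@^~ (0, 0))) /= <-; rewrite linear0.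
  apply; split=> [c x y /= -> ->|v /= /esym/eqP|_ v //]; first by rewrite linearP.
  by rewrite -(linear0 j) => /eqP/jinj.
have {}AJ := AJ A_neq0.
have A00 : A (0, 0) by have := AJ 0; rewrite linear0.
have Adom w : exists v, A (w, v).
  apply: contrapT => wA.
  (* Extends the partial map to the line through [w] by the value [0] there. *)
  pose B : set (W * V) := [set x | exists c, A (x.1 + c *: w, x.2)].
  have /Amax : A `<` B.
    split=> [x Ax|]; first by exists 0; rewrite scale0r addr0 -surjective_pairing.
    move/(_ (w, 0)); apply: contra_not wA => BA; exists 0; apply: BA.
    by exists (- 1); rewrite scaleN1r subrr.
  apply; split=> [d [x v] [y u] [c Ac] [c' Ac']|v [c] /=|_ v].
  - exists (d * c + c') => /=.
    have -> : d *: x + y + (d * c + c') *: w = d *: (x + c *: w) + (y + c' *: w).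
      by rewrite scalerDl scalerDr scalerA addrACA.
    exact: (AD d _ _ Ac Ac').
  - rewrite add0r; have [->|c0] := eqVneq c 0; first by rewrite scale0r => /A0.
    move=> /(AD c^-1 _ (0, 0)) /(_ A00); rewrite addr0 => H.
    exfalso; apply: wA; exists (c^-1 *: v).
    have <- // : c^-1 *: (c *: w, v) = (w, c^-1 *: v).
    by congr (_, _); rewrite /= scalerA mulVf ?scale1r.
  - by exists 0; rewrite scale0r addr0; exact: AJ.
have Auniq w v v' : A (w, v) -> A (w, v') -> v = v'.
  move=> Awv Awv'; have := AD (-1) _ _ Awv' Awv.
  have -> : -1 *: (w, v') + (w, v) = (0, v - v').
    by congr (_, _) => /=; rewrite scaleN1r addrC ?subrr.
  by move/A0/eqP; rewrite subr_eq0 => /eqP.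
have [r rP] := choice Adom.
have r_lin : linear r.
  by move=> c x y; apply: Auniq (rP _) _; exact: (AD c _ _ (rP x) (rP y)).
pose rL : {linear W -> V} := HB.pack r (GRing.isLinear.Build _ _ _ _ r r_lin).
by exists rL => v; exact: Auniq (rP _) (AJ v).
Qed.

(** * Tensor products of commutative algebras *)

Section TensorProduct.
Variables (k : fieldType) (A B : comAlgType k).

Definition bilin (M : lmodType k) (f : A -> B -> M) : Prop :=
  (forall b, linear (f^~ b)) /\ (forall a, linear (f a)).

Definition teval (M : lmodType k) (f : A -> B -> M) (s : seq (A * B)) : M :=
  \sum_(p <- s) f p.1 p.2.

Section Bilin.
Variables (M : lmodType k) (f : A -> B -> M).
Hypothesis fP : bilin f.

Lemma bilinDl a a' b : f (a + a') b = f a b + f a' b.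
Proof. by have := fP.1 b 1 a a'; rewrite !scale1r. Qed.

Lemma bilinDr a b b' : f a (b + b') = f a b + f a b'.
Proof. by have := fP.2 a 1 b b'; rewrite !scale1r. Qed.

Lemma bilin0l b : f 0 b = 0.
Proof. by apply: (addrI (f 0 b)); rewrite -bilinDl !addr0. Qed.

Lemma bilin0r a : f a 0 = 0.
Proof. by apply: (addrI (f a 0)); rewrite -bilinDr !addr0. Qed.

Lemma bilinZl c a b : f (c *: a) b = c *: f a b.
Proof. by have := fP.1 b c a 0; rewrite bilin0l !addr0. Qed.

Lemma bilinZr c a b : f a (c *: b) = c *: f a b.
Proof. by have := fP.2 a c b 0; rewrite bilin0r !addr0. Qed.

Lemma bilin_sumr I (r : seq I) (F : I -> B) a :
  f a (\sum_(i <- r) F i) = \sum_(i <- r) f a (F i).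
Proof. by elim/big_rec2: _ => [|i x y _ <-]; rewrite ?bilin0r ?bilinDr. Qed.

Lemma bilin_mul a b : bilin (fun a' b' => f (a * a') (b * b')).
Proof.
by split=> [b1|a1] c x y; rewrite /= mulrDr -scalerAr ?bilinDl ?bilinDr ?bilinZl ?bilinZr.
Qed.

End Bilin.

(* Elements of the tensor product are formal sums of pure tensors, identified   *)
(* when no bilinear map to any [k]-module separates them: this makes the        *)
(* universal property immediate.                                                *)
Definition tensor_rel : rel (seq (A * B)) := fun s t =>
  `[< forall (M : lmodType k) (f : A -> B -> M), bilin f -> teval f s = teval f t >].

Lemma tensor_rel_refl : reflexive tensor_rel.
Proof. by move=> s; apply/asboolP. Qed.

Lemma tensor_rel_sym : symmetric tensor_rel.
Proof. by move=> s t; apply/asboolP/asboolP => st M f fP; rewrite st. Qed.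

Lemma tensor_rel_trans : transitive tensor_rel.
Proof.
by move=> t s u /asboolP st /asboolP tu; apply/asboolP => M f fP; rewrite st ?tu.
Qed.

Canonical tensor_equiv :=
  EquivRel tensor_rel tensor_rel_refl tensor_rel_sym tensor_rel_trans.

Definition tensor := {eq_quot tensor_equiv}.

HB.instance Definition _ := Choice.on tensor.
HB.instance Definition _ := Quotient.on tensor.

Definition tensor_of (s : seq (A * B)) : tensor := \pi_tensor s.

Lemma tensor_ofP s t : (forall (M : lmodType k) (f : A -> B -> M), bilin f ->
  teval f s = teval f t) <-> tensor_of s = tensor_of t.
Proof. by split=> [?|/eqquotP/asboolP]; first apply/eqquotP/asboolP. Qed.

Definition tlift (M : lmodType k) (f : A -> B -> M) (u : tensor) : M :=
  teval f (repr u).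

Lemma tliftE (M : lmodType k) (f : A -> B -> M) s :
  bilin f -> tlift f (tensor_of s) = teval f s.
Proof. by apply: (tensor_ofP _ _).2; rewrite /tensor_of reprK. Qed.

Lemma tensor_of_ind (P : tensor -> Prop) :
  (forall s, P (tensor_of s)) -> forall u, P u.
Proof. by move=> Ps u; rewrite -[u]reprK; exact: Ps. Qed.

Lemma tensorP (u v : tensor) : (forall (M : lmodType k) (f : A -> B -> M),
  bilin f -> tlift f u = tlift f v) -> u = v.
Proof.
by move=> uv; rewrite -[u]reprK -[v]reprK; apply/tensor_ofP => M f /uv.
Qed.

Definition tadd (u v : tensor) := tensor_of (repr u ++ repr v).
Definition tscale c (u : tensor) :=
  tensor_of [seq (c *: p.1, p.2) | p <- repr u].
Definition tmul (u v : tensor) :=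
  tensor_of [seq (p.1 * q.1, p.2 * q.2) | p <- repr u, q <- repr v].

Lemma tlift_add (M : lmodType k) (f : A -> B -> M) u v :
  bilin f -> tlift f (tadd u v) = tlift f u + tlift f v.
Proof. by move=> fP; rewrite tliftE // /teval big_cat. Qed.

Lemma tlift_scale (M : lmodType k) (f : A -> B -> M) c u :
  bilin f -> tlift f (tscale c u) = c *: tlift f u.
Proof.
move=> fP; rewrite tliftE // /teval big_map scaler_sumr.
by apply: eq_bigr => p _; rewrite bilinZl.
Qed.

Lemma tlift_mul (M : lmodType k) (f : A -> B -> M) u v : bilin f ->
  tlift f (tmul u v) =
  tlift (fun a b => tlift (fun a' b' => f (a * a') (b * b')) v) u.
Proof. by move=> fP; rewrite tliftE // /teval big_allpairs_dep. Qed.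

Lemma bilin_tlift (M : lmodType k) (f : A -> B -> M) v : bilin f ->
  bilin (fun a b => tlift (fun a' b' => f (a * a') (b * b')) v).
Proof.
move=> fP; split=> [b|a] c x y; rewrite /tlift /teval scaler_sumr -big_split;
  apply: eq_bigr => p _; rewrite mulrDl -scalerAl.
  by rewrite bilinDl // bilinZl.
by rewrite bilinDr // bilinZr.
Qed.

Lemma taddA : associative tadd.
Proof. by move=> u v w; apply: tensorP => M f fP; rewrite !tlift_add // addrA. Qed.

Lemma taddC : commutative tadd.
Proof. by move=> u v; apply: tensorP => M f fP; rewrite !tlift_add // addrC. Qed.

Lemma tlift_nil (M : lmodType k) (f : A -> B -> M) :
  bilin f -> tlift f (tensor_of [::]) = 0.
Proof. by move=> fP; rewrite tliftE // /teval big_nil. Qed.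

Lemma tadd0 : left_id (tensor_of [::]) tadd.
Proof. by move=> u; apply: tensorP => M f fP; rewrite tlift_add // tlift_nil // add0r. Qed.

Lemma taddN : left_inverse (tensor_of [::]) (tscale (- 1)) tadd.
Proof.
move=> u; apply: tensorP => M f fP.
by rewrite tlift_add // tlift_scale // tlift_nil // scaleN1r addNr.
Qed.

HB.instance Definition _ := GRing.isZmodule.Build tensor taddA taddC tadd0 taddN.

Lemma tliftD (M : lmodType k) (f : A -> B -> M) (fP : bilin f) :
  {morph tlift f : u v / u + v}.
Proof. by move=> u v; exact: tlift_add. Qed.

Lemma tscaleA a b u : tscale a (tscale b u) = tscale (a * b) u.
Proof. by apply: tensorP => M f fP; rewrite !tlift_scale // scalerA. Qed.

Lemma tscale1 : left_id 1 tscale.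
Proof. by move=> u; apply: tensorP => M f fP; rewrite tlift_scale // scale1r. Qed.

Lemma tscaleDr : right_distributive tscale +%R.
Proof.
move=> c u v; apply: tensorP => M f fP.
by rewrite tliftD // !tlift_scale // tliftD // scalerDr.
Qed.

Lemma tscaleDl u : {morph tscale^~ u : a b / a + b}.
Proof.
move=> a b; apply: tensorP => M f fP.
by rewrite tliftD // !tlift_scale // scalerDl.
Qed.

HB.instance Definition _ := GRing.Zmodule_isLmodule.Build k tensor
  tscaleA tscale1 tscaleDr tscaleDl.

Lemma tliftZ (M : lmodType k) (f : A -> B -> M) (fP : bilin f) c u :
  tlift f (c *: u) = c *: tlift f u.
Proof. exact: tlift_scale. Qed.

Lemma tlift_linear (M : lmodType k) (f : A -> B -> M) : bilin f -> linear (tlift f).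
Proof. by move=> fP c u v; rewrite tliftD // tliftZ. Qed.

Definition tpure a b : tensor := tensor_of [:: (a, b)].

Lemma tlift_pure (M : lmodType k) (f : A -> B -> M) a b :
  bilin f -> tlift f (tpure a b) = f a b.
Proof. by move=> fP; rewrite tliftE // /teval big_seq1. Qed.

Lemma tpure_bilin : bilin tpure.
Proof.
by split=> [b|a] c x y; apply: tensorP => M f fP;
  rewrite tliftD // tliftZ // !tlift_pure // ?bilinDl ?bilinZl ?bilinDr ?bilinZr.
Qed.

Lemma tensor_sum (u : tensor) : exists s : seq (A * B),
  u = \sum_(p <- s) tpure p.1 p.2.
Proof.
elim/tensor_of_ind: u => s; exists s; apply: tensorP => M f fP.
rewrite tliftE //; elim: s => [|p s IHs]; first by rewrite /teval !big_nil tlift_nil.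
by rewrite /teval !big_cons tliftD // tlift_pure // -IHs.
Qed.

Lemma tensor_ind (P : tensor -> Prop) : P 0 ->
  (forall a b u, P u -> P (tpure a b + u)) -> forall u, P u.
Proof.
move=> P0 PD u; have [s ->] := tensor_sum u.
by elim/big_rec: _ => // p v _; exact: PD.
Qed.

Lemma tmulDl : left_distributive tmul +%R.
Proof.
move=> u v w; apply: tensorP => M f fP.
by rewrite tliftD // !tlift_mul // (tliftD (bilin_tlift w fP)).
Qed.

Lemma tmulC : commutative tmul.
Proof.
move=> u v; apply: tensorP => M f fP; rewrite !tlift_mul // /tlift /teval.
rewrite exchange_big; apply: eq_bigr => p _; apply: eq_bigr => q _.
by rewrite mulrC [_.2 * _]mulrC.
Qed.

Lemma tmul_pure a b a' b' : tmul (tpure a b) (tpure a' b') = tpure (a * a') (b * b').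
Proof.
apply: tensorP => M f fP; rewrite tlift_mul // tlift_pure; last exact: bilin_tlift.
by rewrite !tlift_pure //; exact: bilin_mul.
Qed.

Lemma tmul0 u : tmul 0 u = 0.
Proof. by apply: (addrI (tmul 0 u)); rewrite -tmulDl !addr0. Qed.

Lemma tmulr0 u : tmul u 0 = 0.
Proof. by rewrite tmulC tmul0. Qed.

Lemma tmulA : associative tmul.
Proof.
have D u v w : tmul u (v + w) = tmul u v + tmul u w by rewrite tmulC tmulDl !(tmulC u).
elim/tensor_ind => [v w|a b u IHu v w]; first by rewrite !tmul0.
rewrite !tmulDl IHu; congr (_ + _); clear IHu.
move: v w; elim/tensor_ind => [w|a' b' v IHv w]; first by rewrite !(tmul0, tmulr0).
rewrite !(tmulDl, D) IHv; congr (_ + _).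
elim/tensor_ind: w => [|a2 b2 w IHw]; first by rewrite !tmulr0.
by rewrite !D IHw !tmul_pure !mulrA.
Qed.

Lemma tmul1 : left_id (tpure 1 1) tmul.
Proof.
elim/tensor_ind => [|a b u IHu]; first by rewrite tmulr0.
by rewrite tmulC tmulDl ![tmul _ (tpure 1 1)]tmulC IHu tmul_pure !mul1r.
Qed.

(** A retraction of the unit map. Two of them give a bilinear form with value [1] at [(1, 1)], so
    the tensor product is a nonzero ring, as [comAlgType] demands. *)
Lemma unit_functional (R : comAlgType k) : exists2 r : R -> k^o, linear r & r 1 = 1.
Proof.
pose i : k^o -> R := in_alg R.
have iL : linear i by move=> c x y; rewrite /i /= scalerDl scalerA.
pose iR : {linear k^o -> R} := HB.pack i (GRing.isLinear.Build _ _ _ _ i iL).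
have inj : injective iR by exact: (fmorph_inj (in_alg R)).
have [r rK] := linear_retract inj.
by exists r; [exact: linearP|rewrite -[X in r X = _]scale1r; exact: rK].
Qed.

Lemma tensor1_neq0 : tpure 1 1 != 0 :> tensor.
Proof.
have [r rL r1] := unit_functional A; have [r' rL' r1'] := unit_functional B.
have fP : bilin (fun a b => r a * r' b : k^o).
  by split=> [b|a] c x y; rewrite /= ?rL ?rL' ?mulrDl ?mulrDr -?scalerAl -?scalerAr.
apply/eqP => /(congr1 (tlift (fun a b => r a * r' b : k^o))).
rewrite tlift_pure // tlift_nil // r1 r1' mulr1 => /eqP.
by rewrite oner_eq0.
Qed.

HB.instance Definition _ := GRing.Zmodule_isComNzRing.Build tensor
  tmulA tmulC tmul1 tmulDl tensor1_neq0.

Lemma tpure_mul a b a' b' : tpure a b * tpure a' b' = tpure (a * a') (b * b').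
Proof. exact: tmul_pure. Qed.

Lemma tscaleAl (c : k) (u v : tensor) : c *: (u * v) = (c *: u) * v.
Proof.
apply: tensorP => M f fP; rewrite tliftZ // !tlift_mul // tliftZ //.
exact: bilin_tlift.
Qed.

HB.instance Definition _ := GRing.Lmodule_isLalgebra.Build k tensor tscaleAl.
HB.instance Definition _ := GRing.Lalgebra_isComAlgebra.Build k tensor.

End TensorProduct.

(** * Algebra morphisms and the tensor product as a coproduct *)

Section AlgebraMorphisms.
Variable k : fieldType.
Implicit Types A B C R S : comAlgType k.

Definition mk_lrmorphism A R (f : A -> R) (fL : linear f)
    (fM : monoid_morphism f) : {lrmorphism A -> R} :=
  HB.pack f (GRing.isLinear.Build _ _ _ _ f fL)
            (GRing.isMonoidMorphism.Build _ _ f fM).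

Section LRMorphismTheory.
Variables (A R : comAlgType k) (f : {lrmorphism A -> R}).

Lemma lrmorph0 : f 0 = 0. Proof. exact: rmorph0. Qed.
Lemma lrmorph1 : f 1 = 1. Proof. exact: rmorph1. Qed.
Lemma lrmorphD a b : f (a + b) = f a + f b. Proof. exact: rmorphD. Qed.
Lemma lrmorphM a b : f (a * b) = f a * f b. Proof. exact: rmorphM. Qed.
Lemma lrmorphZ c a : f (c *: a) = c *: f a. Proof. exact: linearZ. Qed.
Lemma lrmorph_sum I (r : seq I) (P : pred I) (F : I -> A) :
  f (\sum_(i <- r | P i) F i) = \sum_(i <- r | P i) f (F i).
Proof. exact: raddf_sum. Qed.

End LRMorphismTheory.

Lemma mk_lrmorphismE A R (f : A -> R) (fL : linear f) (fM : monoid_morphism f) a :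
  mk_lrmorphism fL fM a = f a.
Proof. by []. Qed.

#[global] Arguments mk_lrmorphism : simpl never.

Lemma lrcompE A R S (g : {lrmorphism R -> S}) (f : {lrmorphism A -> R}) a :
  lrcomp g f a = g (f a).
Proof. by []. Qed.

Lemma lrcompA A B R S (h : {lrmorphism R -> S}) (g : {lrmorphism B -> R})
    (f : {lrmorphism A -> B}) : lrcomp h (lrcomp g f) = lrcomp (lrcomp h g) f.
Proof. exact: lrmorphism_ext. Qed.

Lemma lrcomp_idl A R (f : {lrmorphism A -> R}) :
  lrcomp (idfun : {lrmorphism R -> R}) f = f.
Proof. exact: lrmorphism_ext. Qed.

Lemma lrcomp_idr A R (f : {lrmorphism A -> R}) :
  lrcomp f (idfun : {lrmorphism A -> A}) = f.
Proof. exact: lrmorphism_ext. Qed.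

Lemma lrcomp_injl A R S (h : {lrmorphism R -> S}) (f g : {lrmorphism A -> R}) :
  injective h -> lrcomp h f = lrcomp h g -> f = g.
Proof.
move=> hI E; apply: lrmorphism_ext => a; apply: hI.
by rewrite -!lrcompE E.
Qed.

Lemma lrmorph_factor A B C (i : {lrmorphism B -> C})
    (f : {lrmorphism A -> C}) : injective i -> (forall a, exists b, i b = f a) ->
  {g : {lrmorphism A -> B} | lrcomp i g = f}.
Proof.
move=> iI fP; have [g gP] := boolp.choice fP.
have gL : linear g by move=> c x y; apply: iI; rewrite lrmorphD lrmorphZ !gP linearP.
have gM : monoid_morphism g.
  split=> [|x y]; apply: iI; first by rewrite gP !lrmorph1.
  by rewrite lrmorphM !gP lrmorphM.
by exists (mk_lrmorphism gL gM); apply: lrmorphism_ext => a; exact: gP.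
Qed.

End AlgebraMorphisms.

Section TensorMorphisms.
Variable k : fieldType.
Implicit Types A B R S : comAlgType k.

Section Copair.
Variables A B S : comAlgType k.

Fact tinl_linear : linear (fun a : A => tpure a (1 : B)).
Proof. exact: (tpure_bilin A B).1. Qed.
Fact tinl_monoid : monoid_morphism (fun a : A => tpure a (1 : B)).
Proof. by split=> // a a'; rewrite tpure_mul mulr1. Qed.
Definition tinl : {lrmorphism A -> tensor A B} :=
  mk_lrmorphism tinl_linear tinl_monoid.

Fact tinr_linear : linear (fun b : B => tpure (1 : A) b).
Proof. exact: (tpure_bilin A B).2. Qed.
Fact tinr_monoid : monoid_morphism (fun b : B => tpure (1 : A) b).
Proof. by split=> // a a'; rewrite tpure_mul mulr1. Qed.
Definition tinr : {lrmorphism B -> tensor A B} :=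
  mk_lrmorphism tinr_linear tinr_monoid.

Lemma tpureE a b : tpure a b = tinl a * tinr b.
Proof. by rewrite !mk_lrmorphismE tpure_mul mulr1 mul1r. Qed.

Lemma lrmorph_bilin (f : {lrmorphism A -> S}) (g : {lrmorphism B -> S}) :
  bilin (fun a b => f a * g b).
Proof. split=> [b|a] c x y; rewrite /= linearP; first by rewrite mulrDl scalerAl.
by rewrite mulrDr scalerAr. Qed.

Fact tcopair_linear (f : {lrmorphism A -> S}) (g : {lrmorphism B -> S}) :
  linear (tlift (fun a b => f a * g b)).
Proof. exact/tlift_linear/lrmorph_bilin. Qed.

Fact tcopair_monoid (f : {lrmorphism A -> S}) (g : {lrmorphism B -> S}) :
  monoid_morphism (tlift (fun a b => f a * g b)).
Proof.
have fgP := lrmorph_bilin f g.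
split; first by rewrite tlift_pure // !rmorph1 mulr1.
elim/tensor_ind => [v|a b u IHu v]; first by rewrite !mul0r /= -[0](scale0r 0) tliftZ // scale0r mul0r.
rewrite mulrDl !(tliftD fgP) IHu mulrDl; congr (_ + _).
elim/tensor_ind: v {u IHu} => [|a' b' v IHv].
  by rewrite !mulr0 /= -[0](scale0r 0) tliftZ // scale0r mulr0.
by rewrite mulrDr !(tliftD fgP) IHv tpure_mul !tlift_pure // !rmorphM mulrACA mulrDr.
Qed.

Definition tcopair (f : {lrmorphism A -> S}) (g : {lrmorphism B -> S}) :
  {lrmorphism tensor A B -> S} := mk_lrmorphism (tcopair_linear f g) (tcopair_monoid f g).

Lemma tcopair_pure f g a b : tcopair f g (tpure a b) = f a * g b.
Proof. exact/tlift_pure/lrmorph_bilin. Qed.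

Lemma tcopair_inl f g : lrcomp (tcopair f g) tinl = f.
Proof. by apply: lrmorphism_ext => a; rewrite lrcompE tcopair_pure rmorph1 mulr1. Qed.

Lemma tcopair_inr f g : lrcomp (tcopair f g) tinr = g.
Proof. by apply: lrmorphism_ext => a; rewrite lrcompE tcopair_pure rmorph1 mul1r. Qed.

Lemma tensor_hom_ext (h h' : {lrmorphism tensor A B -> S}) :
  lrcomp h tinl = lrcomp h' tinl -> lrcomp h tinr = lrcomp h' tinr -> h = h'.
Proof.
move=> El Er; apply: lrmorphism_ext; elim/tensor_ind => [|a b u IHu].
  by rewrite !lrmorph0.
by rewrite !lrmorphD IHu tpureE !lrmorphM -!lrcompE El Er.
Qed.

End Copair.

Definition tmap A B A' B' (f : {lrmorphism A -> A'}) (g : {lrmorphism B -> B'}) :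
  {lrmorphism tensor A B -> tensor A' B'} :=
  tcopair (lrcomp (tinl A' B') f) (lrcomp (tinr A' B') g).

Lemma tmap_pure A B A' B' (f : {lrmorphism A -> A'}) (g : {lrmorphism B -> B'}) a b :
  tmap f g (tpure a b) = tpure (f a) (g b).
Proof. by rewrite tcopair_pure !lrcompE -tpureE. Qed.

Lemma tmap_inl A B A' B' (f : {lrmorphism A -> A'}) (g : {lrmorphism B -> B'}) :
  lrcomp (tmap f g) (tinl A B) = lrcomp (tinl A' B') f.
Proof. exact: tcopair_inl. Qed.

Lemma tmap_inr A B A' B' (f : {lrmorphism A -> A'}) (g : {lrmorphism B -> B'}) :
  lrcomp (tmap f g) (tinr A B) = lrcomp (tinr A' B') g.
Proof. exact: tcopair_inr. Qed.

(** A bilinear test map on [A], [B] extends to [A'], [B'] by composing with retractions of [f] and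
    [g]. These are only linear, so the argument goes through [tlift] rather than [tcopair]. *)
Lemma tmap_inj A B A' B' (f : {lrmorphism A -> A'}) (g : {lrmorphism B -> B'}) :
  injective f -> injective g -> injective (tmap f g).
Proof.
move=> fI gI; have [r rK] := linear_retract fI; have [r' rK'] := linear_retract gI.
move=> u v E; apply: tensorP => M h hP.
have hP' : bilin (fun a b => h (r a) (r' b)).
  by split=> [b|a] c x y; rewrite /= linearP; [apply: hP.1|apply: hP.2].
suff L w : tlift (fun a b => h (r a) (r' b)) (tmap f g w) = tlift h w by rewrite -!L E.
elim/tensor_ind: w => [|a b w IHw].
  by rewrite lrmorph0 -[0 in LHS](scale0r 0) -[0 in RHS](scale0r 0) !tliftZ // !scale0r.
by rewrite lrmorphD !tliftD // IHw tmap_pure !tlift_pure // rK rK'.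
Qed.

Lemma tcopair_tmap A B A' B' S (f : {lrmorphism A -> A'}) (g : {lrmorphism B -> B'})
    (x : {lrmorphism A' -> S}) (y : {lrmorphism B' -> S}) :
  lrcomp (tcopair x y) (tmap f g) = tcopair (lrcomp x f) (lrcomp y g).
Proof.
by apply: tensor_hom_ext; rewrite -!lrcompA !(tcopair_inl, tcopair_inr) lrcompA (tcopair_inl, tcopair_inr).
Qed.

Lemma lrcomp_tcopair A B S (T : comAlgType k) (h : {lrmorphism S -> T})
    (x : {lrmorphism A -> S}) (y : {lrmorphism B -> S}) :
  lrcomp h (tcopair x y) = tcopair (lrcomp h x) (lrcomp h y).
Proof.
by apply: tensor_hom_ext; rewrite -!lrcompA !(tcopair_inl, tcopair_inr).
Qed.

End TensorMorphisms.

(** * Hopf subalgebras and images of homomorphisms *)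

Section Points.
Variables (k : fieldType) (U : affGroup k).
Implicit Types R S : comAlgType k.
Local Notation A := (coord U).

Lemma pmul_lrcomp R S (h : {lrmorphism R -> S}) (x y : {lrmorphism A -> R}) :
  pmul (lrcomp h x) (lrcomp h y) = lrcomp h (pmul x y).
Proof. by rewrite pmul_nat. Qed.

(** Naturality is postulated for the product alone; the image of the unit is idempotent, hence the
    unit. *)
Lemma pone_nat R S (h : {lrmorphism R -> S}) : lrcomp h (pone U R) = pone U S.
Proof.
have := pmul_lrcomp h (pone U R) (pone U R); rewrite pmul1 => E.
by rewrite -[LHS](pmul1 (lrcomp h _)) -(pmulV (lrcomp h (pone U R))) -pmulA E.
Qed.

Lemma pinv_nat R S (h : {lrmorphism R -> S}) (x : {lrmorphism A -> R}) :
  lrcomp h (pinv x) = pinv (lrcomp h x).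
Proof.
rewrite -[LHS]p1mul -(pVmul (lrcomp h x)) pmulA pmul_lrcomp pmulV pone_nat.
exact: pmul1.
Qed.

(** Yoneda: the product of the universal pair of points. Every other product is a specialization of
    it, which is [pmulE]. *)
Definition comult : {lrmorphism A -> tensor A A} := pmul (tinl A A) (tinr A A).

Definition antipode : {lrmorphism A -> A} := pinv (idfun : {lrmorphism A -> A}).

Lemma pmulE R (x y : {lrmorphism A -> R}) : pmul x y = lrcomp (tcopair x y) comult.
Proof. by rewrite pmul_nat tcopair_inl tcopair_inr. Qed.

Lemma pinvE R (x : {lrmorphism A -> R}) : pinv x = lrcomp x antipode.
Proof. by rewrite pinv_nat lrcomp_idr. Qed.

End Points.

Section HopfSubalgebra.
Variables (k : fieldType) (U : affGroup k) (B : comAlgType k).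
Variable j : {lrmorphism B -> coord U}.
Hypothesis j_inj : injective j.
Hypothesis j_comult : forall b, exists t, tmap j j t = comult U (j b).
Hypothesis j_antipode : forall b, exists b', j b' = antipode U (j b).
Implicit Types R S : comAlgType k.

Let comultB : {lrmorphism B -> tensor B B} :=
  sval (lrmorph_factor (f := lrcomp (comult U) j) (tmap_inj j_inj j_inj) j_comult).

Let comultBE : lrcomp (tmap j j) comultB = lrcomp (comult U) j.
Proof. exact: (svalP (lrmorph_factor _ _)). Qed.

Let antipodeB : {lrmorphism B -> B} :=
  sval (lrmorph_factor (f := lrcomp (antipode U) j) j_inj j_antipode).

Let antipodeBE : lrcomp j antipodeB = lrcomp (antipode U) j.
Proof. exact: (svalP (lrmorph_factor _ _)). Qed.

Let bmul R (x y : {lrmorphism B -> R}) := lrcomp (tcopair x y) comultB.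
Let bone R : {lrmorphism B -> R} := lrcomp (pone U R) j.
Let binv R (x : {lrmorphism B -> R}) := lrcomp x antipodeB.

Let bmul_nat R S (h : {lrmorphism R -> S}) (x y : {lrmorphism B -> R}) :
  lrcomp h (bmul x y) = bmul (lrcomp h x) (lrcomp h y).
Proof. by rewrite /bmul lrcompA lrcomp_tcopair. Qed.

Let bone_nat R S (h : {lrmorphism R -> S}) : lrcomp h (bone R) = bone S.
Proof. by rewrite /bone lrcompA pone_nat. Qed.

(* The group laws on points of [B] follow from those of [U]: for the universal *)
(* points, which embed into points of [coord U], by this lemma, and then in      *)
(* general by naturality.                                                        *)
Let bmul_ext R S (h : {lrmorphism R -> S}) (x y : {lrmorphism B -> R})
    (X Y : {lrmorphism coord U -> S}) :
  lrcomp h x = lrcomp X j -> lrcomp h y = lrcomp Y j ->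
  lrcomp h (bmul x y) = lrcomp (pmul X Y) j.
Proof.
move=> Ex Ey; rewrite bmul_nat Ex Ey /bmul pmulE -lrcompA -comultBE lrcompA.
by rewrite tcopair_tmap.
Qed.

Let bmul1 R : left_id (bone R) (@bmul R).
Proof.
move=> x; have E : bmul (bone B) idfun = idfun :> {lrmorphism B -> B}.
  apply: (lrcomp_injl j_inj).
  rewrite (@bmul_ext _ _ _ _ _ (pone U _) (idfun : {lrmorphism _ -> _})).
  - by rewrite pmul1 lrcomp_idl lrcomp_idr.
  - exact: bone_nat.
  - by rewrite lrcomp_idl lrcomp_idr.
have := congr1 (lrcomp x) E.
by rewrite bmul_nat bone_nat !lrcomp_idr.
Qed.

Let b1mul R : right_id (bone R) (@bmul R).
Proof.
move=> x; have E : bmul idfun (bone B) = idfun :> {lrmorphism B -> B}.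
  apply: (lrcomp_injl j_inj).
  rewrite (@bmul_ext _ _ _ _ _ (idfun : {lrmorphism _ -> _}) (pone U _)).
  - by rewrite p1mul lrcomp_idl lrcomp_idr.
  - by rewrite lrcomp_idl lrcomp_idr.
  - exact: bone_nat.
have := congr1 (lrcomp x) E.
by rewrite bmul_nat bone_nat !lrcomp_idr.
Qed.

Let bmulV R : left_inverse (bone R) (@binv R) (@bmul R).
Proof.
move=> x; have E : bmul antipodeB idfun = bone B.
  apply: (lrcomp_injl j_inj).
  rewrite (@bmul_ext _ _ _ _ _ (antipode U) (idfun : {lrmorphism _ -> _})) //.
  - by rewrite pmulV bone_nat.
  - by rewrite lrcomp_idl lrcomp_idr.
have := congr1 (lrcomp x) E.
by rewrite bmul_nat bone_nat !lrcomp_idr.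
Qed.

Let bVmul R : right_inverse (bone R) (@binv R) (@bmul R).
Proof.
move=> x; have E : bmul idfun antipodeB = bone B.
  apply: (lrcomp_injl j_inj).
  rewrite (@bmul_ext _ _ _ _ _ (idfun : {lrmorphism _ -> _}) (antipode U)) //.
  - by rewrite pVmul bone_nat.
  - by rewrite lrcomp_idl lrcomp_idr.
have := congr1 (lrcomp x) E.
by rewrite bmul_nat bone_nat !lrcomp_idr.
Qed.

Let bmulA R : associative (@bmul R).
Proof.
move=> x y z; pose T := tensor (tensor B B) B.
pose i1 : {lrmorphism B -> T} := lrcomp (tinl _ _) (tinl _ _).
pose i2 : {lrmorphism B -> T} := lrcomp (tinl _ _) (tinr _ _).
pose i3 : {lrmorphism B -> T} := tinr _ _.
have E : bmul i1 (bmul i2 i3) = bmul (bmul i1 i2) i3.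
  pose J := tmap (tmap j j) j.
  have J_inj : injective J by apply: tmap_inj j_inj; exact: tmap_inj.
  pose I1 : {lrmorphism coord U -> _} := lrcomp (tinl (tensor (coord U) (coord U)) (coord U)) (tinl _ _).
  pose I2 : {lrmorphism coord U -> _} := lrcomp (tinl (tensor (coord U) (coord U)) (coord U)) (tinr _ _).
  pose I3 : {lrmorphism coord U -> _} := tinr (tensor (coord U) (coord U)) (coord U).
  have E1 : lrcomp J i1 = lrcomp I1 j.
    by rewrite /J /i1 lrcompA tmap_inl -lrcompA tmap_inl lrcompA.
  have E2 : lrcomp J i2 = lrcomp I2 j.
    by rewrite /J /i2 lrcompA tmap_inl -lrcompA tmap_inr lrcompA.
  have E3 : lrcomp J i3 = lrcomp I3 j by rewrite /J /i3 tmap_inr.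
  apply: (lrcomp_injl J_inj).
  rewrite (bmul_ext E1 (bmul_ext E2 E3)) (bmul_ext (bmul_ext E1 E2) E3).
  by rewrite pmulA.
have := congr1 (lrcomp (tcopair (tcopair x y) z)) E.
by rewrite !bmul_nat /i1 /i2 /i3 !lrcompA !tcopair_inl !tcopair_inr.
Qed.

Definition hopf_sub : affGroup k :=
  @AffGroup k B bmul bone binv bmulA bmul1 b1mul bmulV bVmul bmul_nat.

Definition hopf_sub_hom : affHom U hopf_sub.
Proof.
exists j => R x y; symmetry.
change (bmul (lrcomp x j) (lrcomp y j) = lrcomp (pmul x y) j).
by rewrite -(@bmul_ext _ _ (idfun : {lrmorphism R -> R}) (lrcomp x j) (lrcomp y j)) lrcomp_idl.
Defined.

End HopfSubalgebra.

(** * Subalgebras as algebras *)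

Section Subalgebra.
Variables (k : fieldType) (A : comAlgType k) (P : set A) (PP : is_subalgebra P).

(** The closure proof is an argument so that the algebra structure on [subalg] can be inferred from
    the type. *)
Definition subalg_pred of is_subalgebra P : {pred A} := fun a => `[< P a >].

Fact subalg_pred_closed : subalg_closed (subalg_pred PP).
Proof.
have [PC PD PM] := PP; split.
- by apply/asboolP; have := PC 1; rewrite scale1r.
- move=> c x y /asboolP Px /asboolP Py; apply/asboolP; apply: PD => //.
  by rewrite -[x]mul1r scalerAl; exact: PM.
- by move=> x y /asboolP Px /asboolP Py; apply/asboolP; exact: PM.
Qed.

HB.instance Definition _ :=
  GRing.isSubalgClosed.Build k A (subalg_pred PP) subalg_pred_closed.

Record subalg := Subalg { subalg_val : A; subalg_valP : subalg_val \in subalg_pred PP }.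

HB.instance Definition _ := [isSub for subalg_val].
HB.instance Definition _ := [Choice of subalg by <:].
HB.instance Definition _ := [SubChoice_isSubAlgebra of subalg by <:].
HB.instance Definition _ := [SubNzRing_isSubComNzRing of subalg by <:].
HB.instance Definition _ := GRing.Lalgebra_isComAlgebra.Build k subalg.

Fact subalg_val_linear : linear subalg_val.
Proof. exact: (linearP (val : {linear subalg -> A})). Qed.

Fact subalg_val_monoid : monoid_morphism subalg_val.
Proof. by []. Qed.

Definition subalg_incl : {lrmorphism subalg -> A} :=
  mk_lrmorphism subalg_val_linear subalg_val_monoid.

Lemma subalg_incl_inj : injective subalg_incl.
Proof. exact: val_inj. Qed.

Lemma subalg_inclP a : P (subalg_incl a).
Proof. by apply/asboolP; exact: subalg_valP a. Qed.

Lemma subalg_inclK a : P a -> exists b, subalg_incl b = a.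
Proof. by move=> /asboolP Pa; exists (Subalg Pa). Qed.

End Subalgebra.

Section SubalgebraTheory.
Variable k : fieldType.
Implicit Types A R : comAlgType k.

Lemma is_subalgebraZ A (P : set A) c a : is_subalgebra P -> P a -> P (c *: a).
Proof. by move=> [PC _ PM] Pa; rewrite -[a]mul1r scalerAl; apply: PM. Qed.

Lemma is_subalgebra_sum A (P : set A) I (r : seq I) (F : I -> A) :
  is_subalgebra P -> (forall i, P (F i)) -> P (\sum_(i <- r) F i).
Proof.
move=> [PC PD _] PF; elim/big_rec: _ => [|i x _ Px]; last exact: PD.
by rewrite -(scale0r 1).
Qed.

Lemma lrmorph_alg A R (f : {lrmorphism A -> R}) c : f c%:A = c%:A.
Proof. by rewrite lrmorphZ lrmorph1. Qed.

Lemma is_subalgebra_range A R (f : {lrmorphism A -> R}) : is_subalgebra (range f).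
Proof.
split=> [c|_ _ [a _ <-] [b _ <-]|_ _ [a _ <-] [b _ <-]].
- by exists c%:A; rewrite ?lrmorph_alg.
- by exists (a + b); rewrite ?lrmorphD.
- by exists (a * b); rewrite ?lrmorphM.
Qed.

Lemma is_subalgebra_preimage A R (f : {lrmorphism A -> R}) (P : set R) :
  is_subalgebra P -> is_subalgebra (f @^-1` P).
Proof.
move=> [PC PD PM]; split=> [c|a b Pa Pb|a b Pa Pb] /=.
- by rewrite lrmorph_alg.
- by rewrite lrmorphD; exact: PD.
- by rewrite lrmorphM; exact: PM.
Qed.

Lemma smallest_is_subalgebra A (S : set A) : is_subalgebra (smallest (@is_subalgebra k A) S).
Proof.
split=> [c P [[PC _ _] _] //|a b aS bS P PS|a b aS bS P PS].
  by have [[_ D _] _] := PS; apply: D; [exact: aS|exact: bS].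
by have [[_ _ M] _] := PS; apply: M; [exact: aS|exact: bS].
Qed.

Lemma eq_on_generators A R (S : set A) (f g : {lrmorphism A -> R}) :
  generates S -> (forall a, S a -> f a = g a) -> f = g.
Proof.
move=> SA fg; apply: lrmorphism_ext => a.
have aS : smallest (@is_subalgebra k A) S a by rewrite SA.
apply: (aS [set a | f a = g a]); split=> //; split=> [c|x y Ex Ey|x y Ex Ey] /=.
- by rewrite !lrmorph_alg.
- by rewrite !lrmorphD Ex Ey.
- by rewrite !lrmorphM Ex Ey.
Qed.

End SubalgebraTheory.

(** * Images of homomorphisms and quotients of finite type *)

Section Homomorphisms.
Variable k : fieldType.
Implicit Types (U V W : affGroup k) (R : comAlgType k).

Lemma comorph_mul U V (f : affHom U V) R (x y : {lrmorphism coord U -> R}) :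
  lrcomp (pmul x y) (comorph f) = pmul (lrcomp x (comorph f)) (lrcomp y (comorph f)).
Proof. exact: (comorphM f x y). Qed.

Lemma comorph_one U V (f : affHom U V) R :
  lrcomp (pone U R) (comorph f) = pone V R.
Proof.
have := comorph_mul f (pone U R) (pone U R); rewrite pmul1.
set z := lrcomp _ _ => E.
by rewrite -[LHS]pmul1 -(pmulV z) -pmulA -E.
Qed.

Lemma comorph_inv U V (f : affHom U V) R (x : {lrmorphism coord U -> R}) :
  lrcomp (pinv x) (comorph f) = pinv (lrcomp x (comorph f)).
Proof.
rewrite -[LHS]p1mul -(pVmul (lrcomp x (comorph f))) pmulA -comorph_mul pmulV.
by rewrite comorph_one pmul1.
Qed.

Lemma comorph_comult U V (f : affHom U V) :
  lrcomp (comult U) (comorph f) = lrcomp (tmap (comorph f) (comorph f)) (comult V).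
Proof. by rewrite /comult comorph_mul pmulE. Qed.

Lemma comorph_antipode U V (f : affHom U V) :
  lrcomp (antipode U) (comorph f) = lrcomp (comorph f) (antipode V).
Proof. by rewrite /antipode comorph_inv lrcomp_idl -pinvE. Qed.

(** Compatibility of the factored comorphism with comultiplication can be checked in
    [tensor (coord U) (coord U)], because [tmap] of the injection [comorph q] is injective. *)
Lemma quotient_factor U V W (q : affHom U W) (f : affHom U V) :
  quotient_hom q -> (forall v, exists w, comorph q w = comorph f v) ->
  {i : affHom W V | affHom_comp i q = f}.
Proof.
move=> qI /(lrmorph_factor qI)[g qg].
have gM : lrcomp (comult W) g = lrcomp (tmap g g) (comult V).
  apply: (lrcomp_injl (tmap_inj qI qI)).
  rewrite lrcompA -comorph_comult -lrcompA qg comorph_comult lrcompA tcopair_tmap.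
  by rewrite -!lrcompA qg.
have gP R : {morph (fun x : points W R => lrcomp x g : points V R) : x y / (x * y)%g}.
  move=> x y; rewrite [LHS](_ : _ = lrcomp (pmul x y) g) // pmulE -lrcompA gM lrcompA.
  by rewrite tcopair_tmap -pmulE.
by exists (AffHom gP); apply: affHom_ext.
Qed.

(** The coordinate ring of the image is the range of [comorph f], a Hopf subalgebra because
    [comorph f] commutes with comultiplication and antipode. *)
Lemma image_hom U V (f : affHom U V) : exists (W : affGroup k)
  (q : affHom U W) (i : affHom W V), [/\ quotient_hom q, affHom_comp i q = f
    & forall w, exists v, comorph i v = w].
Proof.
pose PP := is_subalgebra_range (comorph f); pose j := subalg_incl PP.
have [|g jg] := lrmorph_factor (f := comorph f) (subalg_incl_inj (PP := PP)).
  by move=> a; apply: subalg_inclK; exists a.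
have HD b : exists t, tmap j j t = comult U (j b).
  have [v _ <-] := subalg_inclP b; exists (tmap g g (comult V v)).
  by rewrite -!lrcompE tcopair_tmap -!lrcompA jg comorph_comult.
have HS b : exists b', j b' = antipode U (j b).
  have [v _ <-] := subalg_inclP b; apply: subalg_inclK; exists (antipode V v) => //.
  by rewrite -!lrcompE comorph_antipode.
pose q := hopf_sub_hom (@subalg_incl_inj _ _ _ PP) HD HS.
have qI : quotient_hom q by exact: subalg_incl_inj.
have [|i iq] := @quotient_factor U V _ q f qI.
  by move=> v; exists (g v); exact: (congr1 (fun h : {lrmorphism _ -> _} => h v) jg).
exists _, q, i; split=> // w; have [v _ vw] := subalg_inclP w.
exists v; apply: qI; rewrite -[RHS]vw.
exact: (congr1 (fun h => comorph h v) iq).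
Qed.

Lemma antipodeK U : involutive (antipode U).
Proof.
move=> a; rewrite -[LHS]/(lrcomp (antipode U) (antipode U) a) -pinvE.
suff -> : pinv (antipode U) = (idfun : {lrmorphism _ -> _}) by [].
rewrite -[LHS]p1mul -(pmulV (idfun : {lrmorphism _ -> _})) pmulA pmulV.
exact: pmul1.
Qed.

Lemma pinvM U R (x y : {lrmorphism coord U -> R}) :
  pinv (pmul x y) = pmul (pinv y) (pinv x).
Proof. exact: (@invgM (points U R : groupType) x y). Qed.

Lemma pmul_sum U R (x y : {lrmorphism coord U -> R}) a (t : seq (coord U * coord U)) :
  comult U a = \sum_(p <- t) tpure p.1 p.2 ->
  pmul x y a = \sum_(p <- t) x p.1 * y p.2.
Proof.
move=> aE; rewrite pmulE lrcompE aE lrmorph_sum.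
by apply: eq_bigr => p _; rewrite tcopair_pure.
Qed.

(** The subalgebra generated by [s] and its antipodes is a Hopf subalgebra: comultiplication of an
    antipode is again expressed by antipodes of elements of [s], and the antipode is an
    involution. *)
Lemma finite_subcoalgebra_quotient U (s : seq (coord U)) :
  (forall a, a \in s -> exists2 t : seq (coord U * coord U),
    (forall p, p \in t -> p.1 \in s /\ p.2 \in s) &
    comult U a = \sum_(p <- t) tpure p.1 p.2) ->
  exists (W : affGroup k) (q : affHom U W), [/\ quotient_hom q, algebraic W
    & forall a, a \in s -> exists w, comorph q w = a].
Proof.
move=> sP; pose S := s ++ map (antipode U) s.
pose PP := smallest_is_subalgebra [set` S]; pose j := subalg_incl PP.
have gen a : a \in S -> exists b, j b = a.
  by move=> aS; apply: subalg_inclK => Q [_]; apply.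
have sI a : a \in s -> exists b, j b = a by move=> h; apply: gen; rewrite mem_cat h.
have SI a : a \in s -> exists b, j b = antipode U a.
  by move=> h; apply: gen; rewrite mem_cat map_f ?orbT.
have subP (Q : set (coord U)) : is_subalgebra Q -> (forall a, a \in S -> Q a) ->
    forall b, Q (j b).
  by move=> QP QS b; have := subalg_inclP b; apply; split.
have HD b : exists t, tmap j j t = comult U (j b).
  suff [t _ tE] : range (tmap j j) (comult U (j b)) by exists t.
  apply: (subP (comult U @^-1` range (tmap j j))).
    exact/is_subalgebra_preimage/is_subalgebra_range.
  have rP := is_subalgebra_range (tmap j j).
  have sumP (t : seq (coord U * coord U)) :
      (forall p, p \in t -> (exists b, j b = p.1) /\ exists b, j b = p.2) ->
      range (tmap j j) (\sum_(p <- t) tpure p.1 p.2).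
    move=> tP; rewrite big_seq; elim/big_rec: _ => [|p x /tP[[b1 <-] [b2 <-]] Px].
      by exists 0 => //; rewrite lrmorph0.
    have [_ D _] := rP; apply: D => //; exists (tpure b1 b2) => //.
    exact: tmap_pure.
  move=> a; rewrite mem_cat => /orP[/sP[t ts aE]|/mapP[{}a /sP[t ts aE] ->]].
    by rewrite /preimage/mkset aE; apply: sumP => p /ts[p1 p2]; split; exact: sI.
  (* Inversion reverses products, so with $S$ the antipode $\Delta(Sa)=\sum S(p_2)\otimes
     S(p_1)$. *)
  rewrite /preimage/mkset -lrcompE -pinvE /comult pinvM.
  rewrite (pmul_sum _ _ aE).
  rewrite [X in range _ X](_ : _ =
      \sum_(p <- [seq (antipode U p.2, antipode U p.1) | p <- t]) tpure p.1 p.2).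
    by apply: sumP => _ /mapP[p /ts[p1 p2] ->]; split; exact: SI.
  by rewrite big_map; apply: eq_bigr => p _; rewrite tpureE !pinvE mulrC.
have HS b : exists b', j b' = antipode U (j b).
  apply: subalg_inclK; apply: (subP (antipode U @^-1` smallest (@is_subalgebra k _) [set` S])).
    exact/is_subalgebra_preimage/smallest_is_subalgebra.
  move=> a aS Q [_ QS]; apply: QS; move: aS; rewrite /mkset !mem_cat => /orP[h|/mapP[b' h ->]].
    by rewrite map_f ?orbT.
  by rewrite antipodeK h.
exists _, (hopf_sub_hom (@subalg_incl_inj _ _ _ PP) HD HS); split.
- exact: subalg_incl_inj.
- have [l lS] : exists l : seq (subalg PP), map j l = S.
    suff H (l : seq (coord U)) : {subset l <= S} -> exists l', map j l' = l by exact: H.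
    elim: l => [|a l IHl] lS; first by exists [::].
    have [l' <-] := IHl (fun x h => lS x (@mem_behead _ (a :: l) x h)).
    by have [b <-] := gen a (lS a (mem_head _ _)); exists (b :: l').
  exists l; rewrite /generates; apply/seteqP; split=> // b _ Q [QP Ql].
  suff [b' Qb' /subalg_incl_inj <-//] : (j @` Q) (j b) by [].
  apply: (subP (j @` Q)).
    have [QC QD QM] := QP; split=> [c|_ _ [x Qx <-] [y Qy <-]|_ _ [x Qx <-] [y Qy <-]].
    + by exists c%:A; rewrite ?lrmorph_alg.
    + by exists (x + y); rewrite ?lrmorphD //; exact: QD.
    + by exists (x * y); rewrite ?lrmorphM //; exact: QM.
  move=> a aS; have : a \in map j l by rewrite lS.
  by move=> /mapP[b' b'l ->]; exists b' => //; exact: Ql.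
- by move=> a /sI.
Qed.

End Homomorphisms.

(** * Local finiteness of the coordinate ring *)

Section BilinearSums.
Variable k : fieldType.
Implicit Types A B S : comAlgType k.

Lemma bilin_flip A B (M : lmodType k) (f : A -> B -> M) :
  bilin f -> bilin (fun b a => f a b).
Proof. by move=> [fl fr]; split. Qed.

(** Solve the relation for one [v i0] with nonzero coefficient and absorb its term into the others;
    [c i] is the coefficient of [v (lift i0 i)] in [v i0]. *)
Lemma bilin_sum_shorten A B (M : lmodType k) (f : A -> B -> M) n
    (u : 'I_n.+1 -> A) (v : 'I_n.+1 -> B) (x : 'rV[k]_n.+1) : bilin f -> x != 0 ->
    \sum_i x 0 i *: v i = 0 ->
  exists i0 (c : 'I_n -> k),
    \sum_i f (u i) (v i) =
    \sum_i f (u (lift i0 i) + c i *: u i0) (v (lift i0 i)).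
Proof.
move=> fP /rV0Pn[i0 xi0] xv.
have vE : v i0 = \sum_i - (x 0 (lift i0 i) / x 0 i0) *: v (lift i0 i).
  apply: (scalerI xi0); apply/eqP; rewrite -subr_eq0 -[X in _ == X]xv.
  rewrite (bigD1_ord i0) //= scaler_sumr -sumrN; apply/eqP; congr (_ + _).
  by apply: eq_bigr => i _; rewrite scalerA mulrN mulrCA divff // mulr1 scaleNr opprK.
exists i0, (fun i => - (x 0 (lift i0 i) / x 0 i0)).
rewrite (bigD1_ord i0) //= addrC {1}vE bilin_sumr // -big_split /=.
by apply: eq_bigr => i _; rewrite bilinDl // bilinZl // bilinZr.
Qed.

(** The coordinates of a linear retraction of $x\mapsto\sum_i x_iv_i$, which is injective for a free
    family. *)
Lemma dual_family A n (v : 'I_n -> A) :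
  (forall x : 'rV[k]_n, \sum_i x 0 i *: v i = 0 -> x = 0) ->
  exists phi : 'I_n -> A -> k^o, (forall i, linear (phi i)) /\
    forall i j, phi i (v j) = (i == j)%:R.
Proof.
move=> vfree; pose J (x : 'rV[k]_n) := \sum_i x 0 i *: v i.
have JL : linear J.
  move=> c x y; rewrite /J scaler_sumr -big_split; apply: eq_bigr => i _.
  by rewrite !mxE scalerDl scalerA.
pose JR : {linear 'rV[k]_n -> A} := HB.pack J (GRing.isLinear.Build _ _ _ _ J JL).
have JI : injective JR.
  move=> x y /eqP; rewrite -subr_eq0 -linearB => /eqP/vfree/eqP.
  by rewrite subr_eq0 => /eqP.
have [r rK] := linear_retract JI.
exists (fun i a => r a 0 i); split=> [i c x y|i j]; first by rewrite linearP !mxE.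
have -> : v j = JR (delta_mx 0 j).
  rewrite /= /J (bigD1 j) //= mxE !eqxx scale1r big1 ?addr0 // => l /negPf lj.
  by rewrite mxE lj andbF scale0r.
by rewrite rK mxE eqxx.
Qed.

(** The slice map $\phi\otimes\mathrm{id}$; [contractr] is $\mathrm{id}\otimes\phi$. *)
Definition contractl A S (phi : A -> k^o) : tensor A S -> S :=
  tlift (fun a s => phi a *: s).
Definition contractr A S (phi : A -> k^o) : tensor S A -> S :=
  tlift (fun s a => phi a *: s).

Lemma contractl_bilin A S (phi : A -> k^o) :
  linear phi -> bilin (fun a (s : S) => phi a *: s).
Proof.
move=> phiL; split=> [s|a] c x y /=; first by rewrite phiL scalerDl scalerA.
by rewrite scalerDr !scalerA mulrC.
Qed.

Lemma contractr_bilin A S (phi : A -> k^o) :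
  linear phi -> bilin (fun (s : S) a => phi a *: s).
Proof. by move=> /(@contractl_bilin A S)/bilin_flip. Qed.

Lemma tlift_sum A B (M : lmodType k) (f : A -> B -> M) I (r : seq I)
    (F : I -> tensor A B) : bilin f ->
  tlift f (\sum_(i <- r) F i) = \sum_(i <- r) tlift f (F i).
Proof.
move=> fP; elim/big_rec2: _ => [|i x y _ <-]; last exact: tliftD.
by rewrite -[0](scale0r 0) tliftZ // scale0r.
Qed.

End BilinearSums.

Section FiniteSubcoalgebra.
Variables (k : fieldType) (U : affGroup k).
Local Notation A := (coord U).

(* A shortest expression of [comult U a] has independent factors on both sides. *)
Lemma comult_minimal (a : A) : exists n (u v : 'I_n -> A),
  [/\ comult U a = \sum_i tpure (u i) (v i),
      forall x : 'rV[k]_n, \sum_i x 0 i *: u i = 0 -> x = 0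
    & forall x : 'rV[k]_n, \sum_i x 0 i *: v i = 0 -> x = 0].
Proof.
pose Q n := `[< exists u v : 'I_n -> A, comult U a = \sum_i tpure (u i) (v i) >].
have [n /asboolP[u [v aE]] nmin] : exists2 n, Q n & forall m, Q m -> (n <= m)%N.
  have exQ : exists n, Q n.
    have [s sE] := tensor_sum (comult U a); exists (size s); apply/asboolP.
    exists (fun i => (tnth (in_tuple s) i).1), (fun i => (tnth (in_tuple s) i).2).
    by rewrite sE big_tnth.
  by case: (ex_minnP exQ) => n Qn nmin; exists n.
exists n, u, v; split=> // x xE; apply/eqP; apply: contraT => x0; exfalso;
  case: n u v aE nmin x x0 xE => [|n] u v aE nmin x x0 xE.
- by rewrite thinmx0 eqxx in x0.
- have [i0 [c]] := bilin_sum_shorten v (bilin_flip (tpure_bilin A A)) x0 xE.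
  rewrite /= -aE => aE'; suff /nmin : Q n by rewrite ltnn.
  by apply/asboolP; exists (fun i => u (lift i0 i)), (fun i => v (lift i0 i) + c i *: v i0).
- by rewrite thinmx0 eqxx in x0.
- have [i0 [c]] := bilin_sum_shorten u (tpure_bilin A A) x0 xE.
  rewrite /= -aE => aE'; suff /nmin : Q n by rewrite ltnn.
  by apply/asboolP; exists (fun i => u (lift i0 i) + c i *: u i0), (fun i => v (lift i0 i)).
Qed.

Lemma pmul_sum_ord (R : comAlgType k) (x y : {lrmorphism A -> R}) a n (u v : 'I_n -> A) :
  comult U a = \sum_i tpure (u i) (v i) -> pmul x y a = \sum_i x (u i) * y (v i).
Proof.
move=> aE; rewrite pmulE lrcompE aE lrmorph_sum.
by apply: eq_bigr => p _; rewrite tcopair_pure.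
Qed.

Fact alg_unit_linear (R : comAlgType k) : linear (fun c : k^o => c%:A : R).
Proof. by move=> c x y; rewrite scalerDl scalerA. Qed.

Fact alg_unit_monoid (R : comAlgType k) : monoid_morphism (fun c : k^o => c%:A : R).
Proof.
by split=> [|x y]; rewrite ?scale1r // -scalerAl mul1r scalerA.
Qed.

Definition alg_unit (R : comAlgType k) : {lrmorphism k^o -> R} :=
  mk_lrmorphism (@alg_unit_linear R) (@alg_unit_monoid R).

Lemma poneE (R : comAlgType k) a : pone U R a = (pone U k^o a)%:A.
Proof. by rewrite -(pone_nat U (alg_unit R)). Qed.

(** This is $(\mathrm{id}\otimes\mathrm{id}\otimes\phi)(b\otimes
    t)=b\otimes(\mathrm{id}\otimes\phi)(t)$, with the triple tensor product bracketed to the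
    left. *)
Lemma contractr_assoc (phi : A -> k^o) (b : A) (t : tensor A A) : linear phi ->
  contractr phi (lrcomp (tinl (tensor A A) A) (tinl A A) b *
    tcopair (lrcomp (tinl (tensor A A) A) (tinr A A)) (tinr (tensor A A) A) t)
  = tpure b (contractr phi t).
Proof.
move=> phiL; have bP := contractr_bilin _ phiL.
have [s ->] := tensor_sum t.
rewrite lrmorph_sum mulr_sumr /contractr !tlift_sum // bilin_sumr; last exact: tpure_bilin.
apply: eq_bigr => p _; rewrite tcopair_pure mulrA !lrcompE -lrmorphM -tpureE.
by rewrite -tpureE !tlift_pure // bilinZr //; exact: tpure_bilin.
Qed.

(** Local finiteness of comodules: the left factors of a shortest expression of $\Delta a$ span a
    finite-dimensional comodule, and its matrix coefficients are closed under comultiplication. [a]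
    is a linear combination of them. *)
Lemma finite_subcoalgebra (a : A) : exists s : seq A,
  (forall b, b \in s -> exists2 t : seq (A * A),
    (forall p, p \in t -> p.1 \in s /\ p.2 \in s) &
    comult U b = \sum_(p <- t) tpure p.1 p.2) /\
  forall P : set A, is_subalgebra P -> (forall b, b \in s -> P b) -> P a.
Proof.
have [n [u [v [aE ufree vfree]]]] := comult_minimal a.
have [psi [psiL psiE]] := dual_family ufree.
have [phi [phiL phiE]] := dual_family vfree.
(* [r] is the matrix of the comodule spanned by the [u j]; coassociativity for  *)
(* [a], and then for the [u j], gives [uE] and [rE].                             *)
pose r i j := contractr (phi j) (comult U (v i)).
pose p1 := lrcomp (tinl (tensor A A) A) (tinl A A).
pose p2 := lrcomp (tinl (tensor A A) A) (tinr A A).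
pose p3 := tinr (tensor A A) A.
have uE j : comult U (u j) = \sum_i tpure (u i) (r i j).
  have phiP := contractr_bilin (tensor A A) (phiL j).
  have := congr1 (fun f : {lrmorphism _ -> _} => contractr (phi j) (f a)) (pmulA p1 p2 p3).
  rewrite !(pmul_sum_ord _ _ aE) /contractr !tlift_sum //.
  have -> : pmul p1 p2 = lrcomp (tinl (tensor A A) A) (comult U) by rewrite pmul_nat.
  under eq_bigr do rewrite pmulE lrcompE -/(contractr _ _) contractr_assoc //.
  move=> ->; rewrite (bigD1 j) // big1 => [|i /negPf ij].
    by rewrite lrcompE -tpureE tlift_pure // phiE eqxx scale1r [RHS]addr0.
  by rewrite lrcompE -tpureE tlift_pure // phiE eq_sym ij scale0r.
pose q1 := tinl A (tensor A A).
pose q2 := lrcomp (tinr A (tensor A A)) (tinl A A).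
pose q3 := lrcomp (tinr A (tensor A A)) (tinr A A).
have q23 x y : q2 x * q3 y = tinr A (tensor A A) (tpure x y).
  by rewrite !lrcompE -lrmorphM -tpureE.
have rE m j : comult U (r m j) = \sum_l tpure (r m l) (r l j).
  have psiP := contractl_bilin (tensor A A) (psiL m).
  have := congr1 (fun f : {lrmorphism _ -> _} => contractl (psi m) (f (u j))) (pmulA q1 q2 q3).
  rewrite !(pmul_sum_ord _ _ (uE j)) /contractl !tlift_sum //.
  have -> : pmul q2 q3 = lrcomp (tinr A (tensor A A)) (comult U) by rewrite pmul_nat.
  rewrite [LHS](bigD1 m) // big1 => [|i /negPf im]; last first.
    by rewrite -tpureE tlift_pure // psiE eq_sym im scale0r.
  rewrite -tpureE tlift_pure // psiE eqxx scale1r [LHS]addr0 => ->.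
  apply: eq_bigr => l _; rewrite (pmul_sum_ord _ _ (uE l)) mulr_suml tlift_sum //.
  rewrite (bigD1 m) // big1 => [|i /negPf im]; last first.
    by rewrite -mulrA q23 -tpureE tlift_pure // psiE eq_sym im scale0r.
  by rewrite -mulrA q23 -tpureE tlift_pure // psiE eqxx scale1r [LHS]addr0.
exists [seq r i j | i <- enum 'I_n, j <- enum 'I_n].
have rs i j : r i j \in [seq r i j | i <- enum 'I_n, j <- enum 'I_n].
  by apply: allpairs_f; rewrite mem_enum.
split=> [_ /allpairsP[[i j] [_ _ ->]]|P PP Ps].
  exists [seq (r i l, r l j) | l <- enum 'I_n].
    by move=> _ /mapP[l _ ->]; split; exact: rs.
  by rewrite big_map big_enum; exact: rE.
(* The counit gives $u_j=\sum_i\varepsilon(u_i)r_{ij}$. *)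
have uP j : P (u j).
  have -> : u j = pmul (pone U A) idfun (u j) by rewrite pmul1.
  rewrite (pmul_sum_ord _ _ (uE j)); apply: is_subalgebra_sum => // i.
  by rewrite poneE -scalerAl mul1r; apply: is_subalgebraZ => //; exact/Ps/rs.
(* Likewise $a=\sum_i\varepsilon(v_i)u_i$. *)
have -> : a = pmul idfun (pone U A) a by rewrite p1mul.
rewrite (pmul_sum_ord _ _ aE); apply: is_subalgebra_sum => // i.
by rewrite poneE -scalerAr mulr1; apply: is_subalgebraZ; last exact: uP.
Qed.

Lemma finite_quotient (a : A) : exists (W : affGroup k) (q : affHom U W),
  [/\ quotient_hom q, algebraic W & exists w, comorph q w = a].
Proof.
have [s [sP sa]] := finite_subcoalgebra a.
have [W [q [qI Walg qs]]] := finite_subcoalgebra_quotient sP.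
exists W, q; split=> //.
have [|b /qs[w <-]|w _ wE] := sa (range (comorph q)).
- exact: is_subalgebra_range.
- by exists w.
- by exists w.
Qed.

End FiniteSubcoalgebra.

(** * The exponential of a unipotent group *)

Section UpperMatrices.
Variables (R : comNzRingType) (m : nat).
Implicit Types (M P : 'M[R]_m) (d e : nat).

(** The filtration by superdiagonals: [upper 1] is strict upper triangularity and [upper m] forces
    zero. *)
Definition upper d M : Prop := forall i j : 'I_m, (j < i + d)%N -> M i j = 0.

Lemma upperD d M P : upper d M -> upper d P -> upper d (M + P).
Proof. by move=> Md Pd i j ij; rewrite mxE Md // Pd // addr0. Qed.

Lemma upperN d M : upper d M -> upper d (- M).
Proof. by move=> Md i j ij; rewrite mxE Md // oppr0. Qed.

Lemma upperM d e M P : upper d M -> upper e P -> upper (d + e) (M *m P).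
Proof.
move=> Md Pe i j ij; rewrite mxE big1 // => l _.
have [li|il] := ltnP l (i + d); first by rewrite Md // mul0r.
by rewrite Pe ?mulr0 // (leq_trans ij) // addnA leq_add2r.
Qed.

Lemma upper_le d e M : (d <= e)%N -> upper e M -> upper d M.
Proof. by move=> de Me i j ij; apply: Me; rewrite (leq_trans ij) // leq_add2l. Qed.

Lemma upper_eq0 M : upper m M -> M = 0.
Proof. by move=> Mm; apply/matrixP => i j; rewrite Mm ?mxE // ltn_addl. Qed.

Lemma upper1 : upper 0 (1%:M : 'M[R]_m).
Proof. by move=> i j; rewrite addn0 mxE ltnNge; case: eqP => // ->; rewrite leqnn. Qed.

Lemma upperX M n : upper 1 M -> upper n (M ^+ n).
Proof.
move=> M1; elim: n => [|n IHn]; first by rewrite expr0; exact: upper1.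
by rewrite exprS -[n.+1]add1n; exact: upperM.
Qed.

Lemma unitriangularB1 M : unitriangular M -> upper 1 (M - 1%:M).
Proof.
move=> Mu i j; rewrite addn1 ltnS => ji.
by rewrite !mxE Mu // subrr.
Qed.

Lemma unitriangular_upper M : unitriangular M -> upper 0 M.
Proof.
move=> /unitriangularB1/(upper_le (leq0n 1))/upperD/(_ upper1).
by rewrite subrK.
Qed.

(** With $N=M-1$, idempotency reads $N=-N^2$, which pushes $N$ up the filtration for ever. An
    embedding [rho] is only assumed multiplicative; this lemma gives [rho1]. *)
Lemma unitriangular_idem M : unitriangular M -> M *m M = M -> M = 1%:M.
Proof.
move=> Mu MM; have N1 := unitriangularB1 Mu; set N := M - 1%:M in N1.
have NE : N = - (N *m N).
  by rewrite /N mulmxBl mulmxBr MM !mulmx1 mul1mx subrr sub0r opprK.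
have Nn n : upper n N.
  elim: n => [|n IHn]; first exact: upper_le N1.
  by rewrite NE -addn1; apply/upperN/upperM.
by apply/eqP; rewrite -subr_eq0; apply/eqP/upper_eq0.
Qed.

End UpperMatrices.

Section UnitriangularPoints.
Variables (k : fieldType) (U : affGroup k) (m : nat).
Variable rho : forall R, points U R -> 'M[R]_m.
Hypothesis rhoP : unitri_embedding rho.
Local Notation r := (rho (idfun : {lrmorphism coord U -> coord U})).

Lemma rhoE R (x : points U R) : rho x = map_mx x r.
Proof.
rewrite -(rho_nat rhoP x (idfun : {lrmorphism _ -> _})).
by congr (rho _); exact: lrmorphism_ext.
Qed.

Lemma rho_inj R : injective (@rho R).
Proof.
move=> x y; rewrite (rhoE x) (rhoE y) => /matrixP xy.
apply: (eq_on_generators (rho_closed rhoP)) => _ [i [j ->]].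
by have := xy i j; rewrite !mxE.
Qed.

Lemma rho1 R : @rho R 1%g = 1%:M.
Proof.
apply: unitriangular_idem; first exact: (rho_unitri rhoP).
by rewrite -(rhoM rhoP) mulg1.
Qed.

Lemma rho_comult i j : comult U (r i j) = \sum_l tpure (r i l) (r l j).
Proof.
have := rhoM rhoP (tinl _ _ : points U _) (tinr _ _ : points U _).
rewrite (rhoE (_ * _)%g) (rhoE (tinl _ _)) (rhoE (tinr _ _)).
move=> /matrixP/(_ i j); rewrite !mxE => ->.
by apply: eq_bigr => l _; rewrite tpureE !mxE.
Qed.

End UnitriangularPoints.

(** * Invariant derivations and their divided powers *)

Section LieDerivation.
Variables (k : fieldType) (U : affGroup k) (X : coord U -> k^o).
Hypothesis XP : is_lie X.
Local Notation A := (coord U).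
Local Notation eps := (pone U k^o).

(* The left-invariant derivation of [coord U] whose value at [1] is [X]. *)
Definition lie_der (a : A) : A := contractr X (comult U a).

Let XL : linear X := XP.1.
Let epsL : linear eps := linearP eps.

Lemma lie_der_linear : linear lie_der.
Proof.
move=> c a b; rewrite /lie_der lrmorphD lrmorphZ.
exact: (tlift_linear (contractr_bilin _ XL)).
Qed.

Lemma contractr_counit a : contractr eps (comult U a) = a.
Proof.
rewrite -[RHS]/((idfun : {lrmorphism A -> A}) a) -(p1mul (idfun : {lrmorphism _ -> _})).
rewrite pmulE lrcompE; have [s ->] := tensor_sum (comult U a).
rewrite lrmorph_sum /contractr tlift_sum; last exact: contractr_bilin.
apply: eq_bigr => p _; rewrite tcopair_pure tlift_pure; last exact: contractr_bilin.
by rewrite [in RHS]poneE -scalerAr mulr1.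
Qed.

Lemma contractl_counit a : contractl eps (comult U a) = a.
Proof.
rewrite -[RHS]/((idfun : {lrmorphism A -> A}) a) -(pmul1 (idfun : {lrmorphism _ -> _})).
rewrite pmulE lrcompE; have [s ->] := tensor_sum (comult U a).
rewrite lrmorph_sum /contractl tlift_sum; last exact: contractl_bilin.
apply: eq_bigr => p _; rewrite tcopair_pure tlift_pure; last exact: contractl_bilin.
by rewrite [in RHS]poneE -scalerAl mul1r.
Qed.

(** [X] is a derivation at the counit, so slicing by [X] is a derivation along slicing by the
    counit. *)
Lemma contractr_lieM (s t : tensor A A) : contractr X (s * t) =
  contractr X s * contractr eps t + contractr eps s * contractr X t.
Proof.
have XB := contractr_bilin A XL; have eB := contractr_bilin A epsL.
have [s' ->] := tensor_sum s; have [t' ->] := tensor_sum t.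
rewrite mulr_suml /contractr !tlift_sum // !mulr_suml -big_split; apply: eq_bigr => p _ /=.
rewrite !mulr_sumr !tlift_sum // -big_split; apply: eq_bigr => q _ /=.
rewrite tpure_mul !tlift_pure // XP.2 scalerDl addrC.
by rewrite -!scalerAl -!scalerAr !scalerA.
Qed.

Lemma lie_derM a b : lie_der (a * b) = lie_der a * b + a * lie_der b.
Proof. by rewrite /lie_der lrmorphM contractr_lieM !contractr_counit. Qed.

(** Both sides are $(\varepsilon\otimes X)(\Delta a)$. *)
Lemma counit_lie_der a : eps (lie_der a) = X a.
Proof.
rewrite -[in RHS](contractl_counit a) /lie_der.
have XB := contractr_bilin A XL; have eB := contractl_bilin A epsL.
pose XR : {linear A -> k^o} := HB.pack X (GRing.isLinear.Build _ _ _ _ X XL).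
rewrite -[RHS]/(XR _).
have [s ->] := tensor_sum (comult U a).
rewrite /contractr /contractl !tlift_sum // lrmorph_sum linear_sum.
apply: eq_bigr => p _; rewrite !tlift_pure // lrmorphZ linearZ /=.
exact: mulrC.
Qed.

Lemma lie_der1 : lie_der 1 = 0.
Proof. by apply: (addrI (lie_der 1)); rewrite -{1}[lie_der 1]mulr1 -{2}[lie_der 1]mul1r -lie_derM mulr1 addr0. Qed.

Lemma lie1 : X 1 = 0.
Proof. by rewrite -counit_lie_der lie_der1 lrmorph0. Qed.

End LieDerivation.

Section DividedPowers.
Variables (k : fieldType) (A : comAlgType k) (D : A -> A).
Hypothesis k_char0 : [pchar k] =i pred0.
Hypothesis D_linear : linear D.
Hypothesis D_leibniz : forall a b, D (a * b) = D a * b + a * D b.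

Let natk_neq0 n : (n.+1%:R : k) != 0.
Proof. by have/pcharf0P -> := k_char0. Qed.

Let D0 : D 0 = 0.
Proof. by have := D_linear (-1) 0 0; rewrite scaler0 addr0 scaleN1r addNr. Qed.

Let DZ c a : D (c *: a) = c *: D a.
Proof. by have := D_linear c a 0; rewrite D0 !addr0. Qed.

(** Dividing by $n!$ removes the binomials from the Leibniz rule, so that divided powers multiply
    like coefficients of polynomials. *)
Definition divided_der n a : A := (n`!%:R^-1 : k) *: iter n D a.

Lemma divided_derS n a : D (divided_der n a) = (n.+1%:R : k) *: divided_der n.+1 a.
Proof.
by rewrite /divided_der DZ scalerA /= factS natrM invfM mulrA divff // mul1r.
Qed.

Lemma divided_derM n a b :
  divided_der n (a * b) = \sum_(i < n.+1) divided_der i a * divided_der (n - i) b.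
Proof.
have DD : {morph D : x y / x + y}.
  by move=> x y; have := D_linear 1 x y; rewrite !scale1r.
elim: n => [|n IHn].
  by rewrite big_ord1 subnn /divided_der /= !fact0 invr1 !scale1r.
apply: (scalerI (natk_neq0 n)); rewrite -divided_derS IHn.
rewrite (big_morph D DD D0).
under eq_bigr => i _ do
  rewrite D_leibniz !divided_derS -!scalerAl -!scalerAr -subSn ?leq_ord //.
rewrite big_split /= scaler_sumr.
(* Split $n+1=i+(n+1-i)$: the two parts come from differentiating the left and the right factor, and
   each loses one end term. *)
have -> : \sum_(i < n.+2) (n.+1%:R : k) *: (divided_der i a * divided_der (n.+1 - i) b)
  = \sum_(i < n.+2) ((i%:R : k) *: (divided_der i a * divided_der (n.+1 - i) b) +
     ((n.+1 - i)%:R : k) *: (divided_der i a * divided_der (n.+1 - i) b)).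
  by apply: eq_bigr => i _; rewrite -scalerDl -natrD subnKC // -ltnS.
rewrite big_split [X in _ = X + _]big_ord_recl /= mulr0n scale0r add0r [X in _ = _ + X]big_ord_recr /=.
rewrite subnn mulr0n scale0r addr0; congr (_ + _).
  by apply: eq_bigr => i _; rewrite /divided_der /bump /= add1n subSS -!scalerAl -!scalerAr.
by apply: eq_bigr => i _; rewrite /divided_der -!scalerAl -!scalerAr [LHS]scalerA [RHS]scalerA [X in X *: _ = _]mulrC.
Qed.

End DividedPowers.

(** * The exponential of a nilpotent matrix *)

Section ExpMatrix.
Variables (k : fieldType) (R : comAlgType k) (m : nat) (N : 'M[k]_m).
Hypothesis k_char0 : [pchar k] =i pred0.
Hypothesis N_nil : forall n, (m <= n)%N -> N ^+ n = 0.

Definition exp_coef n (u : R) : R := (n`!%:R^-1 : k) *: u ^+ n.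

Lemma fact_neq0 n : (n`!%:R : k) != 0.
Proof. by have/pcharf0P -> := k_char0; rewrite -lt0n fact_gt0. Qed.

Lemma invf_fact_bin n i : (i <= n)%N ->
  (n`!%:R^-1 * 'C(n, i)%:R : k) = (n - i)`!%:R^-1 * i`!%:R^-1.
Proof.
move=> ni; rewrite mulrC -invfM -natrM mulnC; apply: (mulIf (fact_neq0 n)).
by rewrite mulfVK ?fact_neq0 // mulrC -(bin_fact ni) natrM mulfK // natrM mulf_neq0 ?fact_neq0.
Qed.

Lemma exp_coefD n u v :
  exp_coef n (u + v) = \sum_(i < n.+1) exp_coef i u * exp_coef (n - i) v.
Proof.
rewrite /exp_coef addrC exprDn scaler_sumr; apply: eq_bigr => i _.
rewrite -scalerAl -scalerAr scalerA -scaler_nat scalerA invf_fact_bin -1?ltnS //.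
by rewrite [v ^+ _ * _]mulrC [X in X *: _]mulrC.
Qed.

(** The matrix $\exp(uN)$; [N_nil] makes the terms from [m] on vanish. *)
Definition exp_mx (u : R) : 'M[R]_m :=
  \sum_(n < m) exp_coef n u *: map_mx (in_alg R) (N ^+ n).

(** The product sums over a square of pairs, the left side over the triangle $i+j<m$; the other
    terms contain $N^{i+j}=0$. *)
Lemma exp_mxD u v : exp_mx (u + v) = exp_mx u *m exp_mx v.
Proof.
pose h i j := (exp_coef i u * exp_coef j v) *: map_mx (in_alg R) (N ^+ (i + j)).
have -> : exp_mx u *m exp_mx v = \sum_(i < m) \sum_(j < m) h i j.
  rewrite /exp_mx mulmx_suml; apply: eq_bigr => i _.
  rewrite mulmx_sumr; apply: eq_bigr => j _.
  rewrite -scalemxAl -scalemxAr scalerA /h exprD.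
  by rewrite -map_mxM.
rewrite /exp_mx.
transitivity (\sum_(n < m) \sum_(i < n.+1) h i (n - i)%N).
  apply: eq_bigr => n _; rewrite exp_coefD scaler_suml; apply: eq_bigr => i _.
  by rewrite /h subnKC // -ltnS.
transitivity (\sum_(0 <= n < m) \sum_(0 <= i < m | (i <= n)%N) h i (n - i)%N).
  rewrite big_mkord; apply: eq_bigr => n _.
  by rewrite -(big_mkord xpredT (fun i => h i (n - i)%N)) (big_nat_widen _ _ m) //=.
rewrite (exchange_big_dep xpredT) //= big_mkord; apply: eq_bigr => i _.
have im : (i <= m)%N by exact: ltnW.
rewrite -[RHS](big_mkord xpredT (h i)) [RHS](big_cat_nat _ (leq_subr i m)) //=.
rewrite [X in _ = _ + X]big_nat_cond [X in _ = _ + X]big1 ?addr0; last first.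
  move=> j; rewrite andbT => /andP[mij _].
  by rewrite /h N_nil ?map_mx0 ?scaler0 // -leq_subLR.
rewrite [LHS](big_cat_nat (leq0n i) im) /= [X in X + _]big_nat_cond big1 ?add0r; last first.
  by move=> j /andP[/andP[_ ji] ij]; move: ji; rewrite ltnNge ij.
rewrite -{1}[i : nat]add0n big_addn [LHS]big_nat_cond [RHS]big_nat_cond.
apply: eq_big => [j|j _]; first by rewrite leq_addl andbT.
by rewrite addnK.
Qed.

End ExpMatrix.

(** * Existence of one-parameter subgroups *)

Section Exponential.
Variables (k : fieldType) (U : affGroup k) (m : nat).
Variable rho : forall R, points U R -> 'M[R]_m.
Hypothesis rhoP : unitri_embedding rho.
Hypothesis k_char0 : [pchar k] =i pred0.
Variable X : coord U -> k^o.
Hypothesis XP : is_lie X.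
Local Notation A := (coord U).
Local Notation eps := (pone U k^o).
Local Notation r := (rho (idfun : {lrmorphism coord U -> coord U})).

Let D : A -> A := lie_der X.
Let DL : linear D := lie_der_linear XP.
Let DM a b : D (a * b) = D a * b + a * D b := lie_derM XP a b.
(** The image of [X] under the differential of [rho]. It is strictly upper triangular since the
    entries of [r] on and below the diagonal are constants, which [X] kills. *)
Let N : 'M[k]_m := \matrix_(i, j) X (r i j).

Let lie0 : X 0 = 0.
Proof. by have := XP.1 (-1) 0 0; rewrite scaler0 addr0 scaleN1r addNr. Qed.

Let N_upper : upper 1 N.
Proof.
move=> i j; rewrite addn1 ltnS => ji; rewrite mxE (rho_unitri rhoP) //.
by case: eqP => _; [exact: lie1 | rewrite mulr0n].
Qed.

Let N_nil n : (m <= n)%N -> N ^+ n = 0.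
Proof. by move=> mn; apply/upper_eq0/(upper_le mn)/upperX. Qed.

Lemma lie_der_coef i j : D (r i j) = \sum_l N l j *: r i l.
Proof.
have XB := contractr_bilin A XP.1.
rewrite /D /lie_der (rho_comult rhoP) /contractr tlift_sum //.
by apply: eq_bigr => l _; rewrite tlift_pure // mxE.
Qed.

(** [D] acts on the matrix [r] as right multiplication by [N]. *)
Lemma iter_lie_der_coef n i j : iter n D (r i j) = \sum_l (N ^+ n) l j *: r i l.
Proof.
have DD : {morph D : x y / x + y} by move=> x y; have := DL 1 x y; rewrite !scale1r.
have D0 : D 0 = 0 by have := DL (-1) 0 0; rewrite scaler0 addr0 scaleN1r addNr.
have DZ c a : D (c *: a) = c *: D a by have := DL c a 0; rewrite D0 !addr0.
elim: n => [|n IHn] /=.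
  rewrite expr0 (bigD1 j) //= big1 ?addr0 => [|l /negPf lj]; first by rewrite mxE eqxx scale1r.
  by rewrite mxE lj scale0r.
rewrite IHn (big_morph D DD D0).
under eq_bigr do rewrite DZ lie_der_coef scaler_sumr.
rewrite exchange_big; apply: eq_bigr => l _.
rewrite exprS mxE scaler_suml; apply: eq_bigr => l' _.
by rewrite scalerA mulrC.
Qed.

(* The Taylor coefficients at [0] of [a] along the one-parameter subgroup of [X]. *)
Definition exp_seq n (a : A) : k := eps (divided_der D n a).

Lemma exp_seq_linear n : linear (exp_seq n : A -> k^o).
Proof.
move=> c a b; rewrite /exp_seq -lrmorphZ -lrmorphD; congr (eps _).
rewrite /divided_der scalerA mulrC -scalerA -scalerDr; congr (_ *: _).
by elim: n => //= n ->; rewrite DL.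
Qed.

Lemma exp_seqM n a b :
  exp_seq n (a * b) = \sum_(i < n.+1) exp_seq i a * exp_seq (n - i) b.
Proof.
rewrite /exp_seq (divided_derM k_char0 DL DM) lrmorph_sum.
by apply: eq_bigr => i _; rewrite lrmorphM.
Qed.

Lemma exp_seq1 n : exp_seq n 1 = (n == 0)%:R.
Proof.
rewrite /exp_seq /divided_der lrmorphZ.
have -> : iter n D 1 = (n == 0)%:R.
  have D0 : D 0 = 0 by have := DL (-1) 0 0; rewrite scaler0 addr0 scaleN1r addNr.
  elim: n => //= n ->; case: eqP => _ //; exact: (lie_der1 XP).
by case: n => [|n]; rewrite ?lrmorph1 ?lrmorph0 ?scaler0 //= fact0 invr1 scale1r.
Qed.

Lemma exp_seq_coef n i j : exp_seq n (r i j) = n`!%:R^-1 * (N ^+ n) i j.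
Proof.
rewrite /exp_seq /divided_der lrmorphZ; congr (_ * _).
rewrite iter_lie_der_coef lrmorph_sum.
have E l : eps (r i l) = (i == l)%:R.
  have /matrixP/(_ i l) := rho1 rhoP (k^o : comAlgType k).
  by rewrite (rhoE rhoP) !mxE.
rewrite (bigD1 i) //= big1 ?addr0 => [|l /negPf li].
  by rewrite lrmorphZ E eqxx [_ *: _]mulr1.
by rewrite lrmorphZ E eq_sym li [_ *: _]mulr0.
Qed.

(** Having only finitely many nonzero Taylor coefficients passes to sums and products, so it is
    enough to check the entries of [r], where it is nilpotency of [N]. *)
Lemma exp_poly_exists a : exists p : {poly k}, forall n, p`_n = exp_seq n a.
Proof.
have : smallest (@is_subalgebra k A) [set a | exists i j, a = r i j] a.
  by rewrite (rho_closed rhoP).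
move=> /(_ [set a | exists p : {poly k}, forall n, p`_n = exp_seq n a]); apply.
split=> [|_ [i [j ->]]]; last first.
  exists (\poly_(n < m) exp_seq n (r i j)) => n; rewrite coef_poly.
  by case: ltnP => // mn; rewrite exp_seq_coef N_nil // mxE mulr0.
split=> [c|x y [p pE] [q qE]|x y [p pE] [q qE]] /=.
- exists c%:P => n; rewrite coefC.
  have e0 : exp_seq n 0 = 0.
    by have := exp_seq_linear n (-1) 0 0; rewrite scaler0 addr0 scaleN1r addNr.
  have := exp_seq_linear n c 1 0; rewrite e0 !addr0 exp_seq1 => ->.
  by case: eqP => _; rewrite [_ *: _](mulr1, mulr0).
- exists (p + q) => n; rewrite coefD pE qE.
  by have := exp_seq_linear n 1 x y; rewrite !scale1r.
- exists (p * q) => n; rewrite coefM exp_seqM.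
  by apply: eq_bigr => i _; rewrite pE qE.
Qed.

(** The comorphism sends [a] to its Taylor polynomial. It respects the group laws because the
    injective [rho] turns it into $x\mapsto\exp(xN)$. *)
Lemma is_exp_exists : exists g : points U k^o, is_exp X g.
Proof.
have [f fE] := boolp.choice exp_poly_exists.
have fL : linear f.
  move=> c a b; apply/polyP => n; rewrite coefD coefZ !fE.
  exact: exp_seq_linear.
have fM : monoid_morphism f.
  split=> [|a b]; apply/polyP => n; first by rewrite coef1 fE exp_seq1.
  by rewrite coefM fE exp_seqM; apply: eq_bigr => i _; rewrite !fE.
pose F : {lrmorphism A -> {poly k}} := mk_lrmorphism fL fM.
have rhoF (R : comAlgType k) (x : {lrmorphism {poly k} -> R}) :
    rho (lrcomp x F : points U R) = exp_mx N (x 'X).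
  rewrite (rhoE rhoP); apply/matrixP => i j; rewrite mxE lrcompE.
  have -> : F (r i j) = \sum_(n < m) (exp_seq n (r i j)) *: 'X^n.
    apply/polyP => n; rewrite -(poly_def m (fun n => exp_seq n (r i j))) coef_poly [LHS]fE.
    by case: ltnP => // mn; rewrite exp_seq_coef N_nil // mxE mulr0.
  rewrite lrmorph_sum summxE; apply: eq_bigr => n _.
  rewrite lrmorphZ exp_seq_coef !mxE /exp_coef rmorphXn /=.
  by rewrite -scalerAl -scalerAr mulr1 scalerA.
have FP R : {morph (fun x : points (Ga k) R => lrcomp x F : points U R) : x y / (x * y)%g}.
  move=> x y; apply: (rho_inj rhoP).
  rewrite (rhoM rhoP) !rhoF -(exp_mxD k_char0 N_nil).
  by congr (exp_mx N _); exact: poly_pointX.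
exists (hom_points (AffHom FP) (poly_point (1 : k^o))), (AffHom FP); split=> // a.
rewrite [RHS](fE a 1) /exp_seq /divided_der lrmorphZ /= invr1 scale1r.
by rewrite (counit_lie_der XP).
Qed.

End Exponential.

Section ExpInjective.
Variables (k : fieldType) (U : affGroup k).
Hypothesis k_char0 : [pchar k] =i pred0.

(** A one-parameter subgroup trivial at [1] is trivial at every natural number. Each coordinate is
    then a polynomial with one value at infinitely many points of [k], hence constant, and [X] reads
    off its linear coefficient. *)
Lemma is_exp1 (X : coord U -> k^o) : is_exp X 1%g -> forall a, X a = 0.
Proof.
move=> [g [XE g1]] a; rewrite XE.
have gn n : hom_points g (poly_point (n%:R : k^o)) = 1%g.
  have gM (x y : points (Ga k) k^o) : hom_points g (x * y)%g = (hom_points g x * hom_points g y)%g.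
    exact: (comorphM g x y).
  elim: n => [|n IHn].
    apply: (mulgI (hom_points g (poly_point (0%:R : k^o)))); rewrite mulg1 -gM; congr (hom_points g _).
    by apply: poly_pointE; rewrite poly_pointX [LHS]poly_pointX !poly_pointX addr0.
  have -> : hom_points g (poly_point (n.+1%:R : k^o)) =
      (hom_points g (poly_point (n%:R : k^o)) * hom_points g (poly_point (1 : k^o)))%g.
    rewrite -gM; congr (hom_points g _).
    by apply: poly_pointE; rewrite poly_pointX [RHS]poly_pointX !poly_pointX -natr1.
  by rewrite IHn mul1g -g1.
pose p := comorph g a; pose c : k := pone U k^o a.
have pn n : root (p - c%:P) n%:R.
  have := congr1 (fun f : points U k^o => f a) (gn n).
  rewrite /hom_points lrcompE -/p => pE.
  rewrite /root hornerD hornerN hornerC subr_eq0; apply/eqP.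
  rewrite -[c]pE.
  change (p.[n%:R] = (map_poly (in_alg k^o) p).[n%:R]).
  by rewrite map_poly_id // => c' _; exact: mulr1.
have p0 : p - c%:P = 0.
  apply: contraTeq isT => pN0.
  have := @max_poly_roots _ (p - c%:P) [seq n%:R | n <- iota 0 (size (p - c%:P))] pN0.
  rewrite size_map size_iota ltnn; apply.
    by apply/allP => _ /mapP[n _ ->].
  rewrite map_inj_uniq ?iota_uniq // => i j ij.
  have E i' j' : (i' <= j')%N -> i'%:R = j'%:R :> k -> i' = j'.
    move=> ij' /esym/eqP; rewrite -subr_eq0 -natrB // ((pcharf0P _).1 k_char0) subn_eq0 => ji'.
    by apply/eqP; rewrite eqn_leq ij'.
  by have [h|/ltnW h] := leqP i j; [exact: E|apply/esym/E].
by have /(congr1 (fun q : {poly k} => q`_1)) := p0; rewrite coefB coefC coef0 subr0.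
Qed.

End ExpInjective.

(** * The topology on rational points *)

Section HomPoints.
Variable k : fieldType.
Implicit Types U V W : affGroup k.

Lemma hom_pointsM U V (f : affHom U V) R (x y : points U R) :
  hom_points f (x * y)%g = (hom_points f x * hom_points f y)%g.
Proof. exact: (comorph_mul f). Qed.

Lemma hom_points1 U V (f : affHom U V) R : hom_points f (1%g : points U R) = 1%g.
Proof. exact: (comorph_one f). Qed.

Lemma hom_points_comp U V W (g : affHom V W) (f : affHom U V) R (x : points U R) :
  hom_points (affHom_comp g f) x = hom_points g (hom_points f x).
Proof. exact: lrcompA. Qed.

Lemma hom_points_inj U V (f : affHom U V) R :
  (forall a, exists b, comorph f b = a) -> injective (@hom_points _ _ _ f R).
Proof.
move=> fS x y xy; apply: lrmorphism_ext => a; have [b <-] := fS a.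
exact: (congr1 (fun h : points V R => h b) xy).
Qed.

Lemma quotient_hom_comp U V W (g : affHom V W) (f : affHom U V) :
  quotient_hom f -> quotient_hom g -> quotient_hom (affHom_comp g f).
Proof. by move=> fI gI; exact: inj_comp. Qed.

Lemma quotient_hom_id U : quotient_hom (affHom_id U).
Proof. by []. Qed.

Lemma pro_unipotent_quotient U V (q : affHom U V) :
  quotient_hom q -> pro_unipotent U -> pro_unipotent V.
Proof. by move=> qQ UP W f fQ; apply: UP (quotient_hom_comp qQ fQ). Qed.

End HomPoints.

Section KPoints.
Variable k : topologicalFieldType.
Implicit Types U V : prounipotentGroup k.

Lemma kpoints_subbase_open U (W : set (kpoints U)) : kpoints_subbase W -> open W.
Proof.
move=> WU; exists [set W]; last by rewrite bigcup_set1.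
move=> _ ->; exists [fset W]%fset; first by move=> X; rewrite !inE => ->.
by rewrite set_fset1 bigcap_set1.
Qed.

Lemma kpoints_continuous (T : topologicalType) U (f : T -> kpoints U) :
  (forall W, kpoints_subbase W -> open (f @^-1` W)) -> continuous f.
Proof.
move=> fW; apply/continuousP => _ [Bs BsP <-].
rewrite preimage_bigcup; apply: bigcup_open => B /BsP [D DP <-].
rewrite bigcap_fset big_seq; elim/big_ind: _ => [|X Y oX oY|X XD].
- by rewrite preimage_setT; exact: openT.
- by rewrite preimage_setI; exact: openI.
- by apply: fW; have /set_mem := DP _ XD.
Qed.

(** A quotient of a quotient is a quotient, so subbasic sets pull back to subbasic sets. *)
Lemma kpoints_map_continuous U V (q : affHom U V) :
  quotient_hom q -> continuous (kpoints_map q).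
Proof.
move=> qQ; apply: kpoints_continuous => _ [W [p [O [pQ Walg Oo ->]]]].
apply: kpoints_subbase_open; exists W, (affHom_comp p q), O; split=> //.
  exact: quotient_hom_comp.
by apply/seteqP; split=> x; rewrite /preimage /mkset hom_points_comp.
Qed.

Hypothesis k_hausdorff : hausdorff_space k.
Hypothesis k_char0 : [pchar k] =i pred0.

(** The Hausdorff property enters here: it makes $\{0\}$ closed in [k]. *)
Lemma row_neq0_open r : open [set x : 'rV[k]_r | x != 0].
Proof.
rewrite openE => x /= /rV0Pn[i xi0].
exists (fun _ j => if j == i then [set c | c != 0] else setT).
  move=> i' j; rewrite (ord1 i'); case: eqP => [->|_]; last exact: filterT.
  apply: open_nbhs_nbhs; split=> //.
  rewrite (_ : [set c | c != 0] = ~` [set 0]).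
    by apply: closed_openC; exact/accessible_closed_set1/hausdorff_accessible.
  by apply/seteqP; split=> c /= /eqP.
move=> y /= /(_ 0 i); rewrite eqxx /= => yi0; apply/rV0Pn; by exists i.
Qed.

(** Since [lie_exp] defaults to [1], the value [1] says something about [X] only because
    [is_exp_exists] provides an exponential; then [is_exp1] and uniqueness of coordinates force the
    row to be zero. *)
Lemma exp_open_neq1 (U : affGroup k) :
  unipotent U -> exp_open [set g : points U k^o | g != 1%g].
Proof.
move=> [m [rho rhoP]] r e [eL eB].
have lieP (x : 'rV[k]_r) : is_lie (lie_comb e x).
  split=> [c a b|a b]; rewrite /lie_comb.
    rewrite scaler_sumr -big_split; apply: eq_bigr => i _.
    by rewrite (eL i).1 mulrDr; congr (_ + _); exact: mulrCA.
  rewrite mulr_sumr mulr_suml -big_split; apply: eq_bigr => i _.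
  by rewrite (eL i).2 mulrDr; congr (_ + _); [exact: mulrCA|exact: mulrA].
have neq1 x : x != 0 -> lie_exp (lie_comb e x) != 1%g.
  apply: contra => /eqP x1; have [g gP] := is_exp_exists rhoP k_char0 (lieP x).
  have := xgetPex 1%g (ex_intro _ g gP); rewrite -/(lie_exp _) x1.
  move=> /(is_exp1 k_char0) X0.
  have [y [_ yU]] := eB _ (lieP x).
  rewrite -(yU x erefl) (yU 0) //; apply/funext => a; rewrite X0.
  by rewrite /lie_comb big1 // => i _; rewrite mxE mul0r.
(* According to the value at [0], the set is the complement of [0] or everything. *)
have [e0|e0] := eqVneq (lie_exp (lie_comb e (0 : 'rV[k]_r))) 1%g.
  rewrite (_ : mkset _ = [set x | x != 0]); first exact: row_neq0_open.
  by apply/seteqP; split=> x /=; [apply: contra => /eqP ->; rewrite e0|exact: neq1].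
rewrite (_ : mkset _ = setT); first exact: openT.
by apply/seteqP; split=> // x _ /=; have [->|/neq1] := eqVneq x 0.
Qed.

(** An algebraic [U] is among its own algebraic quotients, so the set is subbasic. *)
Lemma kpoints_neq1_open U : algebraic U -> open [set g : kpoints U | g != 1%g].
Proof.
move=> Ualg; apply: kpoints_subbase_open.
exists U, (affHom_id U), [set g | g != 1%g]; split=> //.
  exact/exp_open_neq1/(@pro_groupP k U U (affHom_id U)).
apply/seteqP; split=> x /=; congr (_ != 1%g); [symmetry|]; exact: lrcomp_idr.
Qed.

End KPoints.

(** * The tower of completions *)

Section Nilpotency.
Variables (k : fieldType) (U : affGroup k) (m : nat).
Variable rho : forall R, points U R -> 'M[R]_m.
Hypothesis rhoP : unitri_embedding rho.
Variables (G : groupType) (f : G -> points U k^o).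
Hypothesis fM : {morph f : x y / (x * y)%g}.

Let M x := rho (f x).

Let MM x y : M (x * y)%g = M x *m M y.
Proof. by rewrite /M fM (rhoM rhoP). Qed.

Let M1 : M 1%g = 1%:M.
Proof.
rewrite -[RHS](rho1 rhoP) /M; congr (rho _).
by apply: (mulgI (f 1%g)); rewrite -fM !mulg1.
Qed.

Let MV x : M x^-1%g *m M x = 1%:M.
Proof. by rewrite -MM mulVg M1. Qed.

Let M_upper0 x : upper 0 (M x).
Proof. exact/unitriangular_upper/(rho_unitri rhoP). Qed.

Lemma lcs_upper n x : lcs n x -> upper n.+1 (M x - 1%:M).
Proof.
elim: n x => [|n IHn] x xn; first exact/unitriangularB1/(rho_unitri rhoP).
apply: (xn [set z | upper n.+2 (M z - 1%:M)]); split; first split.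
- by rewrite /= M1 subrr => i j _; rewrite mxE.
- move=> y z yn zn /=; rewrite MM.
  have -> : M y *m M z - 1%:M = (M y - 1%:M) *m M z + (M z - 1%:M).
    by rewrite mulmxBl mul1mx addrA subrK.
  by apply: upperD => //; rewrite -[n.+2]addn0; exact: upperM.
- move=> y yn /=.
  have -> : M y^-1%g - 1%:M = - (M y^-1%g *m (M y - 1%:M)).
    by rewrite mulmxBr MV mulmx1 opprB.
  by apply: upperN; rewrite -[n.+2]add0n; exact: upperM.
- move=> _ [y [z [/IHn zn ->]]] /=.
  have -> : [~ y, z]%g = ((z * y)^-1 * (y * z))%g by rewrite /commg conjgE invgM !mulgA.
  pose Y := M y - 1%:M; pose Z := M z - 1%:M.
  (* A group commutator minus [1] is a unit times the ring commutator of [Y] in [upper 1] and [Z] in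
     [upper n.+1], so one superdiagonal is gained. *)
  have -> : M ((z * y)^-1 * (y * z))%g - 1%:M = M (z * y)^-1%g *m (Y *m Z - Z *m Y).
    rewrite MM -[X in _ - X](MV (z * y)%g) -mulmxBr; congr (_ *m _).
    rewrite !MM /Y /Z !mulmxBl !mulmxBr !mul1mx !mulmx1.
    by rewrite !opprB addrACA [RHS]addrACA; apply/matrixP => i j; rewrite !mxE; ring.
  rewrite -[n.+2]add0n; apply: upperM => //; apply: upperD.
    rewrite -add1n; apply: upperM => //; exact/unitriangularB1/(rho_unitri rhoP).
  apply: upperN; rewrite -addn1; apply: upperM => //; exact/unitriangularB1/(rho_unitri rhoP).
Qed.

Lemma lcs_unipotent x : lcs m x -> f x = 1%g.
Proof.
move=> /lcs_upper/(upper_le (leqnSn m))/upper_eq0/eqP; rewrite subr_eq0 => /eqP fx.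
by apply: (rho_inj rhoP); rewrite (rho1 rhoP).
Qed.

End Nilpotency.

(** * Factoring continuous homomorphisms through the quotients of $G$ *)

Section Factorization.
Variables (k : topologicalFieldType) (G : topologicalGroupType).
Hypothesis k_hausdorff : hausdorff_space k.
Hypothesis k_char0 : [pchar k] =i pred0.
Variables (U : prounipotentGroup k) (f : G -> kpoints U).
Hypothesis fP : cont_khom f.

Lemma cont_khom_closed_lcs : algebraic U ->
  exists n, forall x, normal_set (closed_lcs G n) x -> f x = 1%g.
Proof.
move=> Ualg; have [m [rho rhoP]] := @pro_groupP k U U (affHom_id U) (@quotient_hom_id _ U) Ualg.
exists m => x clx; apply/eqP; apply: contraT => fx.
(* A neighbourhood of a point of the closure meets [lcs G m] itself, where [f] is trivial. *)
have /clx[y [/(lcs_unipotent rhoP fP.2) fy1]] : nbhs x (f @^-1` [set g | g != 1%g]).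
  apply: fP.1; apply: open_nbhs_nbhs; split=> //.
  exact: kpoints_neq1_open.
by rewrite /= fy1 eqxx.
Qed.

Lemma cont_khom_factor n : (forall x, normal_set (closed_lcs G n) x -> f x = 1%g) ->
  exists2 g : lcsQuotient G n -> kpoints U, cont_khom g & forall x, g (lcs_coset n x) = f x.
Proof.
move=> f1; pose g (u : lcsQuotient G n) := f (repr u).
have gE x : g (lcs_coset n x) = f x.
  have /f1 : normal_set (closed_lcs G n) ((repr (lcs_coset n x))^-1 * x)%g.
    by apply/coset_mapP; rewrite coset_reprK.
  rewrite fP.2 => E; apply: (mulgI (f (repr (lcs_coset n x))^-1%g)); rewrite E -fP.2 mulVg.
  by apply: (mulgI (f 1%g)); rewrite -fP.2 !mulg1.
exists g => //; split.
  apply/quotient_continuous; rewrite [X in continuous X](_ : _ = f); first exact: fP.1.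
  by apply/funext => x; exact: gE.
elim/coset_ind => x; elim/coset_ind => y.
by rewrite -coset_mapM -!/(lcs_coset _ _) !gE fP.2.
Qed.

End Factorization.

(** * The completion as a limit of the tower *)

Section MalcevTower.
Variables (k : topologicalFieldType) (G : topologicalGroupType).
Hypothesis k_hausdorff : hausdorff_space k.
Hypothesis k_char0 : [pchar k] =i pred0.
Variables (C : malcev k G) (Cn : forall n : nat, malcev k (lcsQuotient G n)).
Local Notation comp := (lcs_component C Cn).
Local Notation trans := (lcs_transition Cn).

(** Only the common composite [h] has to be continuous, so this applies to composites with a closed
    embedding. *)
Lemma malcev_hom_ext (H : topologicalGroupType) (E : malcev k H)
    (U : prounipotentGroup k) (h : H -> kpoints U) (phi psi : affHom E U) :
  cont_khom h -> (forall x, hom_points phi (malcev_unit E x) = h x) ->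
  (forall x, hom_points psi (malcev_unit E x) = h x) -> phi = psi.
Proof.
move=> hP phiE psiE; have [chi [_ chiU]] := malcev_univ E hP.
have <- : chi = phi by apply: chiU; apply/funext => x; exact/esym/phiE.
by apply: chiU; apply/funext => x; exact/esym/psiE.
Qed.

Lemma lcs_componentE n x :
  hom_points (comp n) (malcev_unit C x) = malcev_unit (Cn n) (lcs_coset n x).
Proof.
exact: (congr1 (fun h => h x) (malcev_liftE C (cont_khom_comp (lcs_coset_hom G n) (malcev_unitP (Cn n))))).
Qed.

Lemma cont_khom_quotient (U V : prounipotentGroup k) (q : affHom U V) (h : G -> kpoints U) :
  quotient_hom q -> cont_khom h -> cont_khom (kpoints_map q \o h).
Proof.
move=> qQ [hc hM]; split=> [x|x y /=]; last by rewrite hM; exact: hom_pointsM.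
by apply: continuous_comp; [exact: hc|exact: kpoints_map_continuous].
Qed.

(* [comp n] factors through its image [W], and the universal property of [Cn n] *)
(* splits the inclusion of [W].                                                  *)
Lemma lcs_component_quotient n : quotient_hom (comp n).
Proof.
have [W [q [i [qQ iq iS]]]] := image_hom (comp n).
pose PW := ProunipotentGroup (pro_unipotent_quotient qQ (@pro_groupP _ C)).
have fP : cont_khom (kpoints_map (q : affHom C PW) \o malcev_unit C).
  by apply: cont_khom_quotient => //; exact: malcev_unitP.
have iE x : hom_points i (hom_points q (malcev_unit C x)) = malcev_unit (Cn n) (lcs_coset n x).
  by rewrite -hom_points_comp iq lcs_componentE.
(* Triviality may be tested after [i], which is injective on points since its comorphism is onto;
   there the map factors through [lcs_coset n]. *)
have [x clx|g gP gE] := @cont_khom_factor k G PW _ fP n.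
  apply: (hom_points_inj iS); rewrite [LHS]iE hom_points1.
  have -> : lcs_coset n x = 1%g.
    by apply/coset_mapP; rewrite mulg1; have [_ _] := normal_subgroup (closed_lcs G n); apply.
  by apply: (mulgI (malcev_unit (Cn n) 1%g)); rewrite -(malcev_unitP (Cn n)).2 !mulg1.
pose psi := malcev_lift (Cn n) gP.
have psiE u : hom_points psi (malcev_unit (Cn n) u) = g u.
  exact: (congr1 (fun h => h u) (malcev_liftE (Cn n) gP)).
have E : affHom_comp i (psi : affHom (Cn n) W) = affHom_id (Cn n).
  apply: (malcev_hom_ext (malcev_unitP (Cn n))); elim/coset_ind => x.
    by rewrite hom_points_comp psiE -/(lcs_coset n x) gE [LHS]iE.
  exact: lrcomp_idr.
have psiK : cancel (comorph i) (comorph (psi : affHom (Cn n) W)).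
  by move=> a; exact: (congr1 (fun h => comorph h a) E).
rewrite /quotient_hom -iq => a b ab; exact: (can_inj psiK (qQ _ _ ab)).
Qed.

Lemma lcs_component_cover (a : coord C) : exists n b, comorph (comp n) b = a.
Proof.
have [W [q [qQ Walg [w wE]]]] := finite_quotient a.
pose PW := ProunipotentGroup (pro_unipotent_quotient qQ (@pro_groupP _ C)).
have fP : cont_khom (kpoints_map (q : affHom C PW) \o malcev_unit C).
  by apply: cont_khom_quotient => //; exact: malcev_unitP.
have [n fn] := cont_khom_closed_lcs k_hausdorff k_char0 fP Walg.
have [g gP gE] := cont_khom_factor fP fn.
pose phi := malcev_lift (Cn n) gP.
have E : affHom_comp (phi : affHom (Cn n) W) (comp n) = q.
  apply: (malcev_hom_ext fP) => // x.
  rewrite hom_points_comp lcs_componentE -gE.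
  exact: (congr1 (fun h => h (lcs_coset n x)) (malcev_liftE (Cn n) gP)).
exists n, (comorph (phi : affHom (Cn n) W) w).
by rewrite -wE; exact: (congr1 (fun h => comorph h w) E).
Qed.

Section Universal.
Variables (V : prounipotentGroup k) (c : forall n, affHom V (Cn n)).
Hypothesis cP : forall n, affHom_comp (trans n) (c n.+1) = c n.

(** Comorphisms of the transitions move elements up the tower, so that elements of two levels can be
    compared at the maximum. *)
Lemma lcs_component_lift n m (b : coord (Cn n)) : (n <= m)%N ->
  exists2 b' : coord (Cn m), comorph (comp m) b' = comorph (comp n) b &
    comorph (c m) b' = comorph (c n) b.
Proof.
elim: m => [|m IHm]; first by rewrite leqn0 => /eqP n0; subst n; exists b.
rewrite leq_eqVlt => /orP[/eqP nm|/IHm[b' <- <-]]; first by subst n; exists b.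
exists (comorph (trans m) b').
  exact: (congr1 (fun h => comorph h b') (lcs_component_compat C Cn m)).
exact: (congr1 (fun h => comorph h b') (cP m)).
Qed.

(** Gluing the [c n] is well defined: two preimages of [a], moved to a common level, coincide there
    by [lcs_component_quotient]. *)
Lemma lcs_component_fun (a : coord C) :
  exists v, forall n b, comorph (comp n) b = a -> comorph (c n) b = v.
Proof.
have [n [b <-]] := lcs_component_cover a; exists (comorph (c n) b) => m b' E.
have [d dE <-] := lcs_component_lift b (leq_maxl n m).
have [d' d'E <-] := lcs_component_lift b' (leq_maxr n m).
by congr (comorph _ _); apply: (@lcs_component_quotient (maxn n m)); rewrite dE d'E.
Qed.

(** The comorphism glued from the [c n] is forced, as the [coord (Cn n)] cover [coord C]; its
    algebraic laws involve finitely many elements and hold at a common level. *)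
Lemma lcs_component_univ :
  exists! p : affHom V C, forall n, affHom_comp (comp n) p = c n.
Proof.
have [f fE] := boolp.choice lcs_component_fun.
have f_comp n b : f (comorph (comp n) b) = comorph (c n) b by rewrite -(fE _ n b).
have cover2 a a' : exists n b b', comorph (comp n) b = a /\ comorph (comp n) b' = a'.
  have [n [b <-]] := lcs_component_cover a; have [m [b' <-]] := lcs_component_cover a'.
  have [d dE _] := lcs_component_lift b (leq_maxl n m).
  have [d' d'E _] := lcs_component_lift b' (leq_maxr n m).
  by exists (maxn n m), d, d'.
have fL : linear f.
  move=> x a a'; have [n [b [b' [<- <-]]]] := cover2 a a'.
  by rewrite -lrmorphZ -lrmorphD !f_comp lrmorphD lrmorphZ.
have fM : monoid_morphism f.
  split=> [|a a']; first by rewrite -(lrmorph1 (comorph (comp 0))) f_comp lrmorph1.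
  have [n [b [b' [<- <-]]]] := cover2 a a'.
  by rewrite -lrmorphM !f_comp lrmorphM.
pose F : {lrmorphism coord C -> coord V} := mk_lrmorphism fL fM.
have F_comp n : lrcomp F (comorph (comp n)) = comorph (c n).
  by apply: lrmorphism_ext => b; exact: f_comp.
(* Each element of [coord C] comes from one level, where the glued map is [c n], a homomorphism. *)
have FP R : {morph (fun x : points V R => lrcomp x F : points C R) : x y / (x * y)%g}.
  move=> x y; apply: lrmorphism_ext => a; have [n [b <-]] := lcs_component_cover a.
  rewrite -!lrcompE -lrcompA F_comp [LHS](_ : _ = pmul (lrcomp x (comorph (c n))) (lrcomp y (comorph (c n))) b).
    by rewrite [in RHS]comorph_mul -!lrcompA F_comp.
  by rewrite -comorph_mul.
exists (AffHom FP); split=> [n|p pE]; first exact: affHom_ext.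
apply: affHom_ext; apply: lrmorphism_ext => a; have [n [b <-]] := lcs_component_cover a.
by rewrite [LHS]f_comp -(pE n).
Qed.

End Universal.

End MalcevTower.

Theorem proposition1p2 (k : topologicalFieldType) (k_hausdorff : hausdorff_space k)
  (k_char0 : [pchar k] =i pred0) (G : topologicalGroupType)
  (C : malcev k G) (Cn : forall n : nat, malcev k (lcsQuotient G n)) :
  inhabited (tower_limit (lcs_transition Cn)) /\
  forall L : tower_limit (lcs_transition Cn), affHom_iso (natural_map C L).
Proof.
have univ := lcs_component_univ k_hausdorff k_char0 C (Cn := Cn).
(* [C] with its components is itself a limit. *)
split; first by constructor; exact: (TowerLimit (lcs_component_compat C Cn) univ).
move=> L; rewrite /natural_map /limit_lift; case: cid => p [/= pE _].
(* The inverse is induced by the projections of [L] through the universal property of [C]; both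
   composites are identities by uniqueness. *)
have [g [gE _]] := univ L (limit_proj L) (limit_compat L).
have compA (U1 U2 U3 U4 : affGroup k) (h1 : affHom U1 U2) (h2 : affHom U2 U3) (h3 : affHom U3 U4) :
  affHom_comp h3 (affHom_comp h2 h1) = affHom_comp (affHom_comp h3 h2) h1.
  by apply: affHom_ext; exact: lrmorphism_ext.
have comp1 (U1 U2 : affGroup k) (h : affHom U1 U2) : affHom_comp h (affHom_id U1) = h.
  by apply: affHom_ext; exact: lrmorphism_ext.
exists g; split.
  have [x [_ xU]] := univ C (lcs_component C Cn) (lcs_component_compat C Cn).
  have <- : x = affHom_comp g p by apply: xU => n; rewrite compA gE.
  by apply: xU => n; exact: comp1.
have [x [_ xU]] := limit_univ L (limit_compat L).
have <- : x = affHom_comp p g by apply: xU => n; rewrite compA pE.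
by apply: xU => n; exact: comp1.
Qed.
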